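(* Let $\mu$ be the self-similar probability measure on $[0,1]$ described in the context, with probabilities $\pi_1,\dots,\pi_k$ and contraction ratios $r_1,\dots,r_k$. Put $$\alpha_{\min}:=\min_{1\leq j\leq k}\frac{\log\pi_j}{\log r_j},\qquad \alpha_{\max}:=\max_{1\leq j\leq k}\frac{\log\pi_j}{\log r_j}.$$ For $\alpha\in\mathbb{R}$ let $\underline{E}_\mu(\alpha):=\{t\in(0,1):\underline{\alpha}_\mu(t)=\alpha\}$. Then $\dim_H\underline{E}_\mu(\alpha)=\beta^*(\alpha)$ if $\alpha\in[\alpha_{\min},\alpha_{\max}]$, and $\underline{E}_\mu(\alpha)=\emptyset$ otherwise.
   Context: Let $k\geq 2$ and let $J_1,\dots,J_k$ be nonoverlapping closed (nondegenerate) subintervals of $[0,1]$, ordered from left to right. For $1\leq j\leq k$ let $\psi_j$ be one of the two linear (affine) contractions mapping $[0,1]$ onto $J_j$, and let $r_j:=\mathrm{Lip}(\psi_j)$. Let $(\pi_1,\dots,\pi_k)$ be a probability vector with $\pi_j>0$ for each $j$. Let $F\subset[0,1]$ be the unique nonempty compact set with $F=\bigcup_{j=1}^k\psi_j(F)$, and let $\mu$ be the unique probability measure concentrated on $F$ with $\mu=\sum_{j=1}^k\pi_j\,\mu\circ\psi_j^{-1}$. Standing assumption of the paper: excluded is the degenerate case in which the $J_j$ cover $[0,1]$ and $\pi_j=r_j$ for all $j$. The lower local dimension of $\mu$ at $t\in(0,1)$ is $\underline{\alpha}_\mu(t):=\liminf_{r\to0}\frac{\log\mu(B(t,r))}{\log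 r}$, where $B(t,r):=(t-r,t+r)$. For $q\in\mathbb{R}$, $\beta(q)$ is the unique real number with $\sum_{j=1}^k\pi_j^qr_j^{\beta(q)}=1$, and $\beta^*(\alpha):=\inf_{q\in\mathbb{R}}\{\alpha q+\beta(q)\}$. $\dim_H$ is Hausdorff dimension. *)

(* Defs.v *)
From HB Require Import structures.
From mathcomp Require Import all_boot all_order all_algebra.
From mathcomp Require Import all_classical all_reals all_analysis.

Set Implicit Arguments.
Unset Strict Implicit.
Unset Printing Implicit Defensive.

Import Order.TTheory GRing.Theory Num.Theory.
Import numFieldNormedType.Exports.

Local Open Scope classical_set_scope.
Local Open Scope ring_scope.

Section hausdorff.
Context {R : realType}.
Implicit Types (A U : set R) (s delta : R).

Definition diam U : \bar R :=
  ereal_sup [set z | exists x y, [/\ U x, U y & z = `|x - y|%:E]].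

(* diam(U)^s, with the convention that the empty set has weight 0 even for
   s = 0; a nonempty set has weight 1 for s = 0. *)
Definition gauge s U : \bar R := if U == set0 then 0%E else poweR (diam U) s.

Definition hausdorff_premeasure s delta A : \bar R :=
  ereal_inf [set (\sum_(0 <= i <oo) gauge s (U i))%E | U in
    [set U : (set R)^nat | A `<=` \bigcup_i U i /\
                           forall i, (diam (U i) <= delta%:E)%E]].

Definition hausdorff_measure s A : \bar R :=
  ereal_sup [set hausdorff_premeasure s delta A | delta in [set d : R | 0 < d]].

Definition hausdorff_dim A : \bar R :=
  ereal_inf [set s%:E | s in [set s : R | 0 <= s /\ hausdorff_measure s A = 0%E]].

End hausdorff.

(* The optimal Lipschitz constant of f on [0,1]. *)
Definition Lip {R : realType} (f : R -> R) : R :=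
  inf [set L : R | 0 <= L /\ L.-lipschitz_`[0, 1] f].

Definition affine {R : realType} (f : R -> R) : Prop :=
  exists c d, forall x, f x = c * x + d.

(* Extended-real valued: since lne 0 = -oo, it equals +oo at a point t having
   a neighbourhood of measure 0. *)
Definition lower_local_dim {R : realType}
    (mu : probability (measurableTypeR R) R) (t : R) : \bar R :=
  limf_einf (fun r : R => (lne (mu (ball t r)) * ((ln r)^-1)%:E)%E) 0^'+.

Definition lower_level_set {R : realType}
    (mu : probability (measurableTypeR R) R) (alpha : R) : set R :=
  [set t | 0 < t < 1 /\ lower_local_dim mu t = alpha%:E].

Definition alpha_min {R : realType} (k : nat) (p r : 'I_k -> R) : \bar R :=
  \big[mine/+oo%E]_(j < k) (ln (p j) / ln (r j))%:E.

Definition alpha_max {R : realType} (k : nat) (p r : 'I_k -> R) : \bar R :=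
  \big[maxe/-oo%E]_(j < k) (ln (p j) / ln (r j))%:E.

Definition beta_star {R : realType} (beta : R -> R) (alpha : R) : \bar R :=
  ereal_inf (range (fun q : R => (alpha * q + beta q)%:E)).

(* J_j = [a j, b j]; consecutive intervals may share an endpoint. psi j is
   affine on the whole of R; its restriction to [0,1] is one of the two affine
   maps of [0,1] onto J_j. *)
Definition interval_system {R : realType} (k : nat) (a b : 'I_k -> R)
    (psi : 'I_k -> R -> R) : Prop :=
  [/\ forall j, [/\ 0 <= a j, a j < b j & b j <= 1],
      forall i j : 'I_k, (i < j)%N -> b i <= a j,
      forall j, affine (psi j) &
      forall j, psi j @` `[0, 1]%classic = `[a j, b j]%classic].

Definition self_similar_set {R : realType} (k : nat) (psi : 'I_k -> R -> R)
    (F : set R) : Prop :=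
  [/\ F !=set0, compact F, F `<=` `[0, 1]%classic & F = \bigcup_j (psi j @` F)].

Definition self_similar_measure {R : realType} (k : nat)
    (psi : 'I_k -> R -> R) (p : 'I_k -> R) (F : set R)
    (mu : probability (measurableTypeR R) R) : Prop :=
  mu F = 1%E /\
  forall A : set (measurableTypeR R), measurable A ->
    mu A = (\sum_(j < k) (p j)%:E * mu (psi j @^-1` A))%E.

(* Main.v *)
(* Write J_w for the cylinder of a word w, and r_w, p_w for the products of the
   ratios and of the probabilities along w.

   Upper bound.  If the lower local dimension at t is alpha, then arbitrarily
   small cylinders at, or within a bounded multiple of their length of, t satisfy
   p_w >= c r_w^(alpha + e): a ball meets boundedly many cylinders of its own
   size, as these have disjoint interiors.  If t lies in F, all small cylinders
   containing t satisfy p_w <= c r_w^(alpha - e).  For q >= 0, resp. q < 0, the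
   words of either kind of length at least N give covers whose sums at exponent
   alpha q + beta(q) + e' are tails of a geometric series.  The same two facts
   confine alpha to [alpha_min, alpha_max].

   Lower bound.  Put x_j = log p_j - alpha log r_j and let S(w) be the sum of the
   x_j along w.  If s < beta^*(alpha), then f(q) = sum_j r_j^s e^(q x_j) is bounded
   below by some m > 1, uniformly in q.  Splitting mass in the proportions
   r_j^s e^(q x_j) / f(q) with q = - 2 eta S(w) gives a measure nu on words with
   nu(w) <= r_w^s e^(- eta S(w)^2) m^(- |w| / 2).  Pruning the words with
   S(w)^2 > L |w| therefore costs little mass, and all remaining points have
   p_w = r_w^alpha up to a subexponential factor.  Inserting a word v with J_v
   inside (0, 1) after each square position pushes these points away from the ends
   of their cylinders, so that balls inherit the bound, and changes all exponents by
   a sublinear amount only.  A cover with a small sum would leave an infinite path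
   untouched. *)

Require Import Defs.
From HB Require Import structures.
From mathcomp Require Import all_boot all_order all_algebra.
From mathcomp Require Import all_classical all_reals all_analysis.
From mathcomp Require Import ring lra zify.

Set Implicit Arguments.
Unset Strict Implicit.
Unset Printing Implicit Defensive.

Import Order.TTheory GRing.Theory Num.Theory.
Import numFieldNormedType.Exports.

Local Open Scope classical_set_scope.
Local Open Scope ring_scope.

(** * Integer square roots and the positions of the insertions *)

Fixpoint isqrt n : nat :=
  if n is m.+1 then (if (isqrt m).+1 ^ 2 <= m.+1 then (isqrt m).+1 else isqrt m)%N
  else 0%N.

Lemma isqrtP n : (isqrt n ^ 2 <= n < (isqrt n).+1 ^ 2)%N.
Proof.
elim: n => //= n /andP[n1 n2]; case: ifPn; last first.
  by rewrite -ltnNge => ->; rewrite (leq_trans n1).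
move=> H; rewrite H/=; apply: leq_trans (_ : ((isqrt n).+1 ^ 2).+1 <= _)%N => //.
by rewrite ltn_exp2r.
Qed.

Lemma isqrt_sqr m : isqrt (m ^ 2) = m.
Proof.
have /andP[h1 h2] := isqrtP (m ^ 2).
rewrite leq_exp2r// in h1; rewrite ltn_exp2r// ltnS in h2.
by apply/eqP; rewrite eqn_leq h1 h2.
Qed.

Lemma isqrt_le m n : (m <= n)%N -> (isqrt m <= isqrt n)%N.
Proof.
move=> mn; have /andP[+ _] := isqrtP m; have /andP[_ +] := isqrtP n.
move=> h2 h1; rewrite -ltnS -(ltn_exp2r _ _ (ltn0Sn 1)).
exact: leq_ltn_trans (leq_trans h1 mn) h2.
Qed.

(** True when i + 1 is a perfect square. Letters are counted from 0, so the prefix that ends with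
    letter i has square length. *)
Definition after_square (i : nat) : bool := isqrt i.+1 != isqrt i.

Lemma isqrtS n : isqrt n.+1 = (isqrt n + after_square n)%N.
Proof.
rewrite /after_square /=; case: ifP => _; last by rewrite eqxx addn0.
by rewrite gtn_eqF//= addn1.
Qed.

Lemma after_square_sqr m : after_square (m.+1 ^ 2).-1.
Proof.
have e : ((m.+1 ^ 2).-1.+1 = m.+1 ^ 2)%N by rewrite prednK// expn_gt0.
rewrite /after_square e isqrt_sqr neq_ltn; apply/orP; right.
rewrite -(ltn_exp2r _ _ (ltn0Sn 1)); have /andP[+ _] := isqrtP (m.+1 ^ 2).-1.
by move/leq_ltn_trans; apply; rewrite e.
Qed.

Lemma ltn_sqrS n m : (n < m.+1 ^ 2)%N -> (n.+1 <= m ^ 2 + 2 * m.+1)%N.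
Proof. by rewrite -!mulnn; lia. Qed.

(** * Elementary estimates *)

Section real_estimates.
Context {R : realType}.

Lemma finite_gap (T : finType) (f : T -> R) : (forall j, f j < 0) ->
  exists2 lam, 0 < lam & forall j, f j <= - lam.
Proof.
move=> f0; have s0 : 0 <= \sum_j (- f j)^-1.
  by apply: sumr_ge0 => j _; rewrite invr_ge0 oppr_ge0 ltW.
(* The sum of the reciprocals stands in for their maximum; the added 1 keeps the witness positive
   when [T] is empty. *)
exists (1 + \sum_j (- f j)^-1)^-1; first by rewrite invr_gt0 ltr_pwDl.
move=> j; rewrite lerNr -[leRHS]invrK lef_pV2 ?posrE ?invr_gt0 ?oppr_gt0 ?ltr_pwDl//.
rewrite (bigD1 j)//= addrCA lerDl addr_ge0// sumr_ge0// => i _.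
by rewrite invr_ge0 oppr_ge0 ltW.
Qed.

Lemma expR_decay (C lam e : R) : 0 < C -> 0 < lam -> 0 < e ->
  exists N0, forall N, (N0 <= N)%N -> C * expR (- (lam * N%:R)) <= e.
Proof.
move=> C0 lam0 e0; exists (Num.bound (`|ln (C / e)| / lam)) => N N0.
have : `|ln (C / e)| / lam <= N%:R.
  apply: (le_trans (ltW (archi_boundP _))); first by rewrite divr_ge0// ltW.
  by rewrite ler_nat.
rewrite ler_pdivrMr// [N%:R * _]mulrC => /(le_trans (ler_norm _)) lnC.
rewrite expRN ler_pdivrMr ?expR_gt0// mulrC -ler_pdivrMr//.
by rewrite -[leLHS]lnK ?posrE ?divr_gt0// ler_expR.
Qed.

Lemma small_factor (x y : R) : 0 <= x -> 0 < y -> exists2 e, 0 < e & e * x <= y.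
Proof.
move=> x0 y0; have x1 : 0 < x + 1 by rewrite ltr_wpDl.
exists (y / (x + 1)); first by rewrite divr_gt0.
by rewrite mulrAC ler_pdivrMr// ler_pM2l// lerDl.
Qed.

Lemma ln2_ge0 : 0 <= ln 2 :> R.
Proof. by rewrite ln_ge0// ler1n. Qed.

(** At depth m^2 the error terms of the lower bound are linear in m, while the logarithm of the
    scale is at least of order m^2. *)
Lemma linear_le_sqr (K e : R) : 0 < e ->
  exists m0, forall m, (m0 <= m)%N -> K * (m%:R + 1) <= e * m%:R ^+ 2.
Proof.
move=> e0; exists (maxn 1 (Num.bound (2 * `|K| / e))) => m.
rewrite geq_max => /andP[m1 mb].
have m1' : 1 <= m%:R :> R by rewrite ler1n.
have : 2 * `|K| / e <= m%:R.
  apply: le_trans (ltW (archi_boundP _)) _; last by rewrite ler_nat.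
  by rewrite divr_ge0 ?mulr_ge0// ltW.
rewrite ler_pdivrMr// => H.
apply: (@le_trans _ _ (`|K| * (2 * m%:R))).
  apply: (@le_trans _ _ (`|K| * (m%:R + 1))).
    by rewrite ler_wpM2r ?ler_norm// addr_ge0.
  by rewrite ler_wpM2l//; lra.
have := ler_wpM2r (ler0n R m) H; lra.
Qed.

End real_estimates.

(** * Lower limits at 0 from the right, and logarithmic ratios as power bounds *)

Section lower_limit_right.
Context {R : realType}.
Implicit Types (f : R -> \bar R) (c : \bar R).
Local Open Scope ereal_scope.

Lemma limf_einf_right_ge f c (d : R) : (0 < d)%R ->
  (forall r : R, (0 < r < d)%R -> c <= f r) -> c <= limf_einf f 0^'+.
Proof.
move=> d0 H; rewrite limf_einfE; apply: le_ereal_sup_tmp.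
exists (ereal_inf [set f x | x in [set r : R | 0 < r < d]%R]).
  exists [set r : R | (0 < r < d)%R] => //.
  exists d => //= x /=; rewrite sub0r normrN => xd x0.
  by rewrite x0 (le_lt_trans (ler_norm _) xd).
by apply: le_ereal_inf_tmp => _ [r /= rd <-]; exact: H.
Qed.

Lemma limf_einf_right_le f c :
  (forall d : R, (0 < d)%R -> exists2 r : R, (0 < r < d)%R & f r <= c) ->
  limf_einf f 0^'+ <= c.
Proof.
move=> H; rewrite limf_einfE; apply: ge_ereal_sup => _ [V [d /= d0 dV] <-].
have [r /andP[r0 rd] fr] := H _ d0.
apply: le_trans fr; apply: ereal_inf_lbound; exists r => //.
by apply: dV => //=; rewrite sub0r normrN gtr0_norm.
Qed.

Lemma limf_einf_right_lt f c (d : R) : limf_einf f 0^'+ < c -> (0 < d)%R ->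
  exists2 r : R, (0 < r < d)%R & f r < c.
Proof.
move=> fc d0; apply: contrapT => H; move: fc; rewrite ltNge => /negP; apply.
apply: (limf_einf_right_ge d0) => r rd; rewrite leNgt; apply/negP => fr.
by apply: H; exists r.
Qed.

Lemma limf_einf_right_gt f c : c < limf_einf f 0^'+ ->
  exists2 d : R, (0 < d)%R & forall r : R, (0 < r < d)%R -> c < f r.
Proof.
move=> fc; apply: contrapT => H; move: fc; rewrite ltNge => /negP; apply.
apply: limf_einf_right_le => d d0; apply: contrapT => H'; apply: H; exists d => //.
move=> r rd; rewrite ltNge; apply/negP => fr.
by apply: H'; exists r.
Qed.

(** As log r < 0, clearing the denominator reverses the inequality. For m = 0 the ratio is +oo and
    both sides hold. *)
Lemma le_log_ratio (m : \bar R) (c r : R) : (0 < r < 1)%R -> 0 <= m <= 1 ->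
  (c%:E <= lne m * ((ln r)^-1)%:E) = (m <= (expR (c * ln r))%:E).
Proof.
move=> r01 /andP[m0 m1].
have lnr : (ln r < 0)%R by exact: ln_lt0.
case: m m0 m1 => [x| |] // x0 x1.
move: x0; rewrite lee_fin le_eqVlt => /predU1P[<-|x0].
  by rewrite le0_lneNy// lt0_mulNye ?lte_fin ?invr_lt0 ?leey ?lee_fin ?expR_ge0.
rewrite lne_EFin// -EFinM !lee_fin ler_ndivlMr//.
by rewrite -[in RHS](lnK x0) ler_expR.
Qed.

Lemma log_ratio_le (m : \bar R) (c r : R) : (0 < r < 1)%R -> 0 <= m <= 1 ->
  (lne m * ((ln r)^-1)%:E <= c%:E) = ((expR (c * ln r))%:E <= m).
Proof.
move=> r01 /andP[m0 m1].
have lnr : (ln r < 0)%R by exact: ln_lt0.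
case: m m0 m1 => [x| |] // x0 x1.
move: x0; rewrite lee_fin le_eqVlt => /predU1P[<-|x0].
  rewrite le0_lneNy// lt0_mulNye ?lte_fin ?invr_lt0 // leye_eq/=.
  by rewrite lee_fin leNgt expR_gt0.
rewrite lne_EFin// -EFinM !lee_fin ler_ndivrMr//.
by rewrite -[in RHS](lnK x0) ler_expR.
Qed.

End lower_limit_right.

(** * Hausdorff measure and sums over words *)

Section hausdorff_covers.
Context {R : realType}.
Implicit Types (A U : set R) (s d e : R).

Lemma diam_le U d : (forall x y, U x -> U y -> `|x - y| <= d) ->
  (diam U <= d%:E)%E.
Proof.
move=> H; apply: ge_ereal_sup => _ [x [y [Ux Uy ->]]].
by rewrite lee_fin H.
Qed.

Lemma diam_ge U x y : U x -> U y -> (`|x - y|%:E <= diam U)%E.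
Proof. by move=> Ux Uy; apply: ereal_sup_ubound; exists x, y. Qed.

Lemma diam_ge0 U : U !=set0 -> (0 <= diam U)%E.
Proof. by move=> [x Ux]; have := diam_ge Ux Ux; rewrite subrr normr0. Qed.

Lemma gauge_ge0 s U : (0 <= gauge s U)%E.
Proof. by rewrite /gauge; case: ifP => // _; exact: poweR_ge0. Qed.

Lemma gauge_set0 s : gauge s (set0 : set R) = 0%E.
Proof. by rewrite /gauge eqxx. Qed.

Lemma gauge_le s d U : 0 <= s -> 0 <= d -> (diam U <= d%:E)%E ->
  (gauge s U <= (d `^ s)%:E)%E.
Proof.
move=> s0 d0 Ud; rewrite /gauge; case: ifPn => [_|/set0P U0].
  by rewrite lee_fin powR_ge0.
have := diam_ge0 U0; case: (diam U) Ud => // x xd x0.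
by rewrite poweR_EFin lee_fin ge0_ler_powR.
Qed.

(* The gauge controls the [t]-th power of some positive scale, even when the
   diameter vanishes and [s = 0]. *)
Lemma gauge_scale s t e U : 0 <= s -> s < t -> 0 < e -> U !=set0 ->
  (diam U <= 1)%E ->
  exists d, [/\ 0 < d, d <= 1, forall x y, U x -> U y -> `|x - y| <= d &
               ((d `^ t)%:E <= gauge s U + e%:E)%E].
Proof.
move=> s0 st e0 U0 U1; have t0 : 0 < t by exact: le_lt_trans st.
have := diam_ge0 U0; case dU : (diam U) U1 => [x| |] //; rewrite !lee_fin => x1 x0.
(* The second entry keeps the scale positive when the diameter [x] vanishes, and its t-th power is
   at most e. *)
pose d := Num.max x (Num.min 1 (e `^ t^-1)).
have et : 0 < e `^ t^-1 by exact: powR_gt0.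
have d0 : 0 < d by rewrite lt_max lt_min ltr01 et orbT.
exists d; split=> //.
- by rewrite ge_max x1 ge_min lexx.
- move=> y z Uy Uz; rewrite le_max; apply/orP; left.
  by rewrite -lee_fin -dU diam_ge.
- have -> : gauge s U = (x `^ s)%:E.
    by rewrite /gauge dU poweR_EFin ifF//; apply/negbTE/set0P.
  rewrite -EFinD lee_fin /d maxEle; case: ifPn => [xm|]; last first.
    rewrite -ltNge => mx; have x'0 : 0 < x by apply: lt_trans mx; rewrite lt_min ltr01.
    apply: (@le_trans _ _ (x `^ s)); last by rewrite lerDl ltW.
    by rewrite ger_powR ?x'0//= ltW.
  apply: (@le_trans _ _ e); last by rewrite lerDr powR_ge0.
  rewrite [leRHS](_ : e = (e `^ t^-1) `^ t); last first.
    by rewrite -powRrM mulVf ?gt_eqF// powRr1// ltW.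
  by rewrite ge0_ler_powR ?nnegrE ?(ltW t0) ?le_min ?ler01 ?(ltW et)// ge_min lexx orbT.
Qed.

Lemma hausdorff_premeasure_countable (T : countType) (U : T -> set R) s d A M :
  0 <= d -> A `<=` \bigcup_t U t -> (forall t, (diam (U t) <= d%:E)%E) ->
  (forall X : seq T, uniq X -> (\sum_(t <- X) gauge s (U t) <= M)%E) ->
  (hausdorff_premeasure s d A <= M)%E.
Proof.
move=> d0 AU Ud XM.
(* Numbers that code no index receive the empty set, which weighs nothing. Partial sums of the
   series are thus sums over duplicate-free lists of indices. *)
pose V i := oapp U set0 (@pickle_inv T i).
apply: (@le_trans _ _ (\sum_(0 <= i <oo) gauge s (V i))%E).
  apply: ereal_inf_lbound; exists V => //; split.
    move=> x /AU [t _ Utx]; exists (pickle t) => //.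
    by rewrite /V pickleK_inv.
  move=> i; rewrite /V; case: pickle_inv => //= ; apply: diam_le => //.
apply: lime_le; first by apply: is_cvg_nneseries => *; exact: gauge_ge0.
near=> n.
rewrite [leLHS](_ : _ =
    \sum_(t <- pmap (@pickle_inv T) (index_iota 0 n)) gauge s (U t))%E.
  apply: XM; apply: pmap_uniq (iota_uniq _ _); exact: pickle_invK.
rewrite big_pmap; apply: eq_bigr => i _; rewrite /V.
by case: pickle_inv => //=; rewrite gauge_set0.
Unshelve. all: by end_near. Qed.

Lemma hausdorff_measure_eq0 s A :
  (forall d e, 0 < d -> 0 < e -> (hausdorff_premeasure s d A <= e%:E)%E) ->
  hausdorff_measure s A = 0%E.
Proof.
move=> H; apply/eqP; rewrite eq_le; apply/andP; split.
  apply: ge_ereal_sup => _ [d /= d0 <-].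
  by apply/lee_addgt0Pr => e e0; rewrite add0e; exact: H.
apply: le_ereal_sup_tmp; exists (hausdorff_premeasure s 1 A).
  by exists 1 => //=; exact: ltr01.
apply: le_ereal_inf_tmp => _ [V _ <-]; apply: nneseries_ge0 => *; exact: gauge_ge0.
Qed.

Lemma hausdorff_dim_le s A : 0 <= s -> hausdorff_measure s A = 0%E ->
  (hausdorff_dim A <= s%:E)%E.
Proof. by move=> s0 sA; apply: ereal_inf_lbound; exists s. Qed.

End hausdorff_covers.

Fixpoint words (k n : nat) : seq (seq 'I_k) :=
  if n is m.+1 then [seq j :: w | j <- enum 'I_k, w <- words k m]
  else [:: [::]].

Section word_sums.
Context {R : realType} {k : nat}.
Implicit Types (h : 'I_k -> R) (w : seq 'I_k).

Lemma mem_words n w : (w \in words k n) = (size w == n).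
Proof.
elim: n w => [|n IH] [|j w] //=.
  by apply/negbTE/allpairsP => -[] ? [].
apply/allpairsP/idP => [[[i v] /= [_ vn [_ ->]]]|wn].
  by rewrite eqSS -IH.
by exists (j, w); rewrite /= mem_enum IH.
Qed.

Lemma words_uniq n : uniq (words k n).
Proof.
elim: n => //= n IH; apply: allpairs_uniq => //; first exact: enum_uniq.
by move=> [i v] [j w] _ _ /= [-> ->].
Qed.

Lemma sum_words h n :
  \sum_(w <- words k n) \prod_(j <- w) h j = (\sum_j h j) ^+ n.
Proof.
elim: n => [|n IH] /=; first by rewrite big_seq1 big_nil expr0.
rewrite big_allpairs_dep exprS -IH mulr_suml big_enum/=.
apply: eq_bigr => j _; rewrite mulr_sumr; apply: eq_bigr => w _.
by rewrite big_cons.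
Qed.

Lemma size_words n : size (words k n) = (k ^ n)%N.
Proof.
by elim: n => //= n IH; rewrite size_allpairs size_enum_ord IH expnS.
Qed.

Lemma sum_uniq_le (T : eqType) (X Y : seq T) (g : T -> R) :
  (forall t, 0 <= g t) -> uniq X -> uniq Y -> {subset X <= Y} ->
  \sum_(t <- X) g t <= \sum_(t <- Y) g t.
Proof.
move=> g0 uX uY XY.
have /(perm_big _)/= -> : perm_eq X [seq t <- Y | t \in X].
  apply: uniq_perm => //; first exact: filter_uniq.
  by move=> t; rewrite mem_filter; case: (boolP (t \in X)) => //= /XY.
rewrite big_filter [leLHS]big_mkcond/=; apply: ler_sum => t _.
by case: ifP.
Qed.

Lemma sum_long_words h (t : R) N (X : seq (seq 'I_k)) :
  (forall j, 0 <= h j) -> \sum_j h j <= t -> 0 < t < 1 -> uniq X ->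
  (forall w, w \in X -> (N <= size w)%N) ->
  \sum_(w <- X) \prod_(j <- w) h j <= t ^+ N / (1 - t).
Proof.
move=> h0 ht /andP[t0 t1] uX XN.
have g0 w : 0 <= \prod_(j <- w) h j by apply: prodr_ge0.
(* All lengths occurring in [X] lie in [N, N + B), and the words of length n together weigh at most
   t^n. *)
pose B := (\max_(w <- X) size w).+1.
pose Y := flatten [seq words k n | n <- index_iota N (N + B)].
apply: (@le_trans _ _ (\sum_(w <- Y) \prod_(j <- w) h j)).
  apply: sum_uniq_le => //.
    rewrite /Y; have : uniq (index_iota N (N + B)) by exact: iota_uniq.
    elim: index_iota => //= n l IH /andP[nl ul].
    rewrite cat_uniq words_uniq IH // andbT /=; apply/hasPn => w /flatten_mapP[m ml].
    rewrite !mem_words => /eqP ->; apply: contra nl => /eqP <-//.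
  move=> w wX; apply/flatten_mapP; exists (size w); last by rewrite mem_words.
  rewrite mem_index_iota XN//= addnC /B addSn ltnS (leq_trans _ (leq_addr _ _))//.
  by rewrite (big_rem w)//= leq_maxl.
rewrite /Y big_flatten big_map/=.
under eq_bigr do rewrite sum_words.
apply: (@le_trans _ _ (\sum_(N <= n < N + B) t ^+ n)).
  by apply: ler_sum => n _; rewrite lerXn2r// nnegrE; [exact: sumr_ge0|exact: ltW].
by rewrite geometric_partial_tail geometric_le_lim// ?exprn_ge0 ?gtr0_norm// ltW.
Qed.

Lemma infinite_path_avoiding (nu : seq 'I_k -> R) (V : nat -> seq (seq 'I_k)) :
  (forall w, 0 <= nu w) -> nu [::] = 1 ->
  (forall w, \sum_j nu (rcons w j) = nu w) ->
  (\sum_(0 <= i <oo) (\sum_(v <- V i) nu v)%:E < 1)%E ->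
  exists om : nat -> 'I_k, forall n i, mkseq om n \notin V i.
Proof.
move=> nu0 nu1 nuS V1.
(* If the words of the [V i] below [w] weigh less than [w], the same holds for
   some child of [w]; following such children avoids all of them. *)
pose L w i := \sum_(v <- V i | prefix w v) nu v.
have L0 w i : 0 <= L w i by apply: sumr_ge0.
pose loss w := (\sum_(0 <= i <oo) (L w i)%:E)%E.
have loss_step w : (loss w < (nu w)%:E)%E ->
    exists j, (loss (rcons w j) < (nu (rcons w j))%:E)%E.
  move=> lw; apply: contrapT => /forallNP H; move: lw; rewrite ltNge => /negP; apply.
  rewrite -nuS -sumEFin.
  apply: (@le_trans _ _ (\sum_j loss (rcons w j))%E).
    by apply: lee_sum => j _; rewrite leNgt; apply/negP.
  rewrite /loss -nneseries_sum; last by move=> *; rewrite lee_fin.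
  apply: lee_nneseries => i _.
    by move=> _; apply: sume_ge0 => *; rewrite lee_fin.
  rewrite sumEFin lee_fin /L.
  under eq_bigr do rewrite big_mkcond/=.
  rewrite exchange_big/= [leRHS]big_mkcond/=; apply: ler_sum => v _.
  (* A proper extension of [w] extends exactly one child of [w]. The word [w] itself extends no
     child, which only lowers the left side. *)
  case: ifPn => [/prefixP[v' ->]|wv].
    case: v' => [|j0 v'].
      rewrite big1// => j _; rewrite ifF//; apply/negbTE/negP => /size_prefix.
      by rewrite cats0 size_rcons ltnn.
    rewrite (bigD1 j0)//= -cat_rcons prefix_prefix big1 ?addr0// => j jj0.
    rewrite ifF//; apply/negbTE/negP; rewrite prefixE size_rcons.
    rewrite -(size_rcons w j0) take_size_cat// => /eqP /rcons_inj[] jj.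
    by rewrite jj eqxx in jj0.
  rewrite big1// => j _; rewrite ifF//; apply/negbTE; apply: contra wv.
  exact: prefix_trans (prefix_rcons _ _).
have loss0 : (loss [::] < (nu [::])%:E)%E.
  rewrite nu1; apply: le_lt_trans V1; apply: lee_nneseries => i _.
    by rewrite lee_fin.
  by rewrite lee_fin /L; under eq_bigl do rewrite prefix0s.
pose st := {w | (loss w < (nu w)%:E)%E}.
have next (x : st) : {j | (loss (rcons (sval x) j) < (nu (rcons (sval x) j))%:E)%E}.
  by apply: cid; apply: loss_step; exact: (svalP x).
pose step (x : st) : st := exist _ (rcons (sval x) (sval (next x))) (svalP (next x)).
pose W n : st := iter n step (exist _ [::] loss0).
exists (fun n => sval (next (W n))) => n i.
have -> : mkseq (fun n => sval (next (W n))) n = sval (W n).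
  by elim: n => //= n IH; rewrite mkseqS IH.
(* A chosen word lying in [V i] would contribute its whole mass to its own loss. *)
apply/negP => WV; have := svalP (W n); rewrite ltNge => /negP; apply.
apply: (@le_trans _ _ (L (sval (W n)) i)%:E).
  by rewrite lee_fin /L (big_rem (sval (W n)))//= prefix_refl lerDl sumr_ge0.
apply: (@le_trans _ _ (\sum_(0 <= j < i.+1) (L (sval (W n)) j)%:E)%E).
  by rewrite big_nat_recr//= leeDr// sume_ge0// => *; rewrite lee_fin.
by apply: nneseries_lim_ge => *; rewrite lee_fin.
Qed.

End word_sums.

(** * Cylinders *)

Section iterated_function_system.
Context {R : realType} {k : nat} (psi : 'I_k -> R -> R) (c : 'I_k -> R).
Context (psiB : forall j x y, psi j x - psi j y = c j * (x - y)).
Context (c01 : forall j, 0 < `|c j| < 1).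
Context (psi01 : forall j x, 0 <= x <= 1 -> 0 <= psi j x <= 1).
(** Nonoverlap of the intervals. One argument ranges over the open interval only, because
    neighbouring intervals may share an endpoint. *)
Context (psi_sep : forall i j x y, i != j ->
  0 <= x <= 1 -> 0 < y < 1 -> psi i x != psi j y).
Implicit Types (u v w : seq 'I_k) (x y : R).

Definition psiw w x := foldr psi x w.
(** Products along words are handled through logarithms: the length of the cylinder of [w] is
    [expR (wsum lnr w)]. *)
Definition wsum (g : 'I_k -> R) w := \sum_(j <- w) g j.
Definition lnr (j : 'I_k) := ln `|c j|.

Lemma wsum_cat g u v : wsum g (u ++ v) = wsum g u + wsum g v.
Proof. by rewrite /wsum big_cat. Qed.

Lemma wsum_rcons g u j : wsum g (rcons u j) = wsum g u + g j.
Proof. by rewrite /wsum -cats1 big_cat/= big_seq1. Qed.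

Lemma wsum_cons g u j : wsum g (j :: u) = g j + wsum g u.
Proof. by rewrite /wsum big_cons. Qed.

Lemma wsum_nil g : wsum g [::] = 0.
Proof. by rewrite /wsum big_nil. Qed.

Lemma psiw_cat u v x : psiw (u ++ v) x = psiw u (psiw v x).
Proof. by rewrite /psiw foldr_cat. Qed.

Lemma lnr_lt0 j : lnr j < 0.
Proof. by rewrite /lnr ln_lt0. Qed.

Lemma expR_lnr j : expR (lnr j) = `|c j|.
Proof. by rewrite /lnr lnK// posrE; case/andP: (c01 j). Qed.

Lemma psiw_dist w x y : `|psiw w x - psiw w y| = expR (wsum lnr w) * `|x - y|.
Proof.
elim: w => [|j w IH] /=; first by rewrite wsum_nil expR0 mul1r.
by rewrite psiB normrM IH wsum_cons expRD expR_lnr mulrA.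
Qed.

Lemma psiw01 w x : 0 <= x <= 1 -> 0 <= psiw w x <= 1.
Proof. by move=> x01; elim: w => //= j w IH; exact: psi01. Qed.

Lemma psi_oo j x : 0 < x < 1 -> 0 < psi j x < 1.
Proof.
move=> /andP[x0 x1]; have /andP[c0 _] := c01 j.
have /andP[a0 a1] := psi01 j (x := 0) ltac:(by rewrite lexx ler01).
have /andP[b0 b1] := psi01 j (x := 1) ltac:(by rewrite lexx ler01).
have E1 := psiB j x 0; have E2 := psiB j 1 x.
move: c0; rewrite normr_gt0 neq_lt => /orP[cl|cg].
- have ? : c j * (x - 0) < 0 by rewrite subr0 nmulr_rlt0.
  have ? : c j * (1 - x) < 0 by rewrite nmulr_rlt0// subr_gt0.
  by apply/andP; split; lra.
- have ? : 0 < c j * (x - 0) by rewrite subr0 mulr_gt0.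
  have ? : 0 < c j * (1 - x) by rewrite mulr_gt0// subr_gt0.
  by apply/andP; split; lra.
Qed.

Lemma psiw_oo w x : 0 < x < 1 -> 0 < psiw w x < 1.
Proof. by move=> x01; elim: w => //= j w IH; exact: psi_oo. Qed.

Lemma psi_inj j : injective (psi j).
Proof.
move=> x y /eqP; rewrite -subr_eq0 psiB mulf_eq0 subr_eq0.
by have /andP[+ _] := c01 j; rewrite normr_gt0 => /negbTE ->/= /eqP.
Qed.

Lemma psiw_inj w : injective (psiw w).
Proof. by elim: w => //= j w IH x y /psi_inj/IH. Qed.

Lemma psiw_sep w i j u v x y : i != j -> 0 <= x <= 1 -> 0 < y < 1 ->
  psiw (w ++ i :: u) x != psiw (w ++ j :: v) y.
Proof.
move=> ij x01 y01; rewrite !psiw_cat; apply/eqP => /psiw_inj/= /eqP.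
by apply/negP/psi_sep => //; [exact: psiw01|exact: psiw_oo].
Qed.

Lemma wsum_le g h w : (forall j, g j <= h j) -> wsum g w <= wsum h w.
Proof. by move=> gh; apply: ler_sum. Qed.

Lemma wsum_const a w : wsum (fun=> a) w = a * (size w)%:R.
Proof.
by elim: w => [|j w IH]; rewrite ?wsum_nil ?mulr0// wsum_cons IH /= mulrS mulrDr mulr1.
Qed.

Lemma wsumZ a g w : wsum (fun j => a * g j) w = a * wsum g w.
Proof. by rewrite /wsum mulr_sumr. Qed.

Lemma wsumD g h w : wsum (fun j => g j + h j) w = wsum g w + wsum h w.
Proof. by rewrite /wsum big_split. Qed.

Lemma wsum_le0 g w : (forall j, g j <= 0) -> wsum g w <= 0.
Proof. by move=> g0; rewrite /wsum sumr_le0. Qed.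

(* The letter at position [n] of [u] is followed by [vins] if [ins (i + n)]. *)
Fixpoint insert (vins : seq 'I_k) (ins : pred nat) i u : seq 'I_k :=
  if u is j :: u' then j :: (if ins i then vins else [::]) ++ insert vins ins i.+1 u'
  else [::].

Lemma insert_rcons vins ins i u j : insert vins ins i (rcons u j) =
  insert vins ins i u ++ j :: (if ins (i + size u)%N then vins else [::]).
Proof.
elim: u i => [|h u IH] i /=; first by rewrite addn0 cats0.
by rewrite IH addSnnS catA.
Qed.

Lemma insert_none vins i u : insert vins xpred0 i u = u.
Proof. by elim: u i => //= j u IH i; rewrite IH. Qed.

Lemma lnr_gap : exists2 lam, 0 < lam &
  forall w, wsum lnr w <= - (lam * (size w)%:R).
Proof.
have [lam lam0 H] := finite_gap lnr_lt0; exists lam => // w.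
by rewrite -mulNr -wsum_const; exact: wsum_le.
Qed.

Lemma psiw_slope w : exists2 s, `|s| = expR (wsum lnr w) &
  forall x y, psiw w x - psiw w y = s * (x - y).
Proof.
elim: w => [|j w [s sE H]].
  by exists 1 => [|x y] /=; rewrite ?wsum_nil ?expR0 ?normr1 ?mul1r.
exists (c j * s) => [|x y] /=; first by rewrite normrM sE wsum_cons expRD expR_lnr.
by rewrite psiB H mulrA.
Qed.

(** The image of (0,1) under [psiw w], written as a ball so that measurability and Lebesgue measure
    are those of balls. *)
Definition open_cyl w : set R := ball (psiw w (1 / 2)) (expR (wsum lnr w) / 2).

Lemma open_cylP w y : open_cyl w y <-> exists2 x, 0 < x < 1 & y = psiw w x.
Proof.
have [s sE H] := psiw_slope w.
have s0 : 0 < `|s| by rewrite sE expR_gt0.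
rewrite /open_cyl -ball_normE /= -sE; split => [yb|[x x01 ->]].
  have sn : s != 0 by rewrite -normr_gt0.
  pose x := 1 / 2 + (y - psiw w (1 / 2)) / s.
  have xE : x - 1 / 2 = (y - psiw w (1 / 2)) / s by rewrite /x addrAC subrr add0r.
  exists x; last first.
    have := H x (1 / 2); rewrite xE [s * _]mulrC divfK//.
    by move=> /addIr ->.
  have : `|x - 1 / 2| < 1 / 2.
    rewrite xE normrM normfV ltr_pdivrMr//.
    by rewrite distrC; lra.
  by rewrite ltr_norml => /andP[? ?]; apply/andP; split; lra.
rewrite H normrM ltr_pM2l// ltr_norml.
by case/andP: x01 => ? ?; apply/andP; split; lra.
Qed.

Lemma open_cyl_diam w x y : open_cyl w y -> 0 <= x <= 1 ->
  `|psiw w x - y| <= expR (wsum lnr w).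
Proof.
move=> /open_cylP[z z01 ->] x01; rewrite psiw_dist ler_piMr ?expR_ge0//.
by rewrite ler_norml; move: z01 x01 => /andP[? ?] /andP[? ?]; apply/andP; split; lra.
Qed.

Lemma lebesgue_open_cyl w :
  lebesgue_measure (open_cyl w) = (expR (wsum lnr w))%:E.
Proof.
rewrite lebesgue_measure_ball ?divr_ge0 ?expR_ge0//.
by congr EFin; lra.
Qed.

(** * Stopped words, and the number of cylinders of one scale that meet a set *)

Section stopping.
Context (vins : seq 'I_k) (ins : pred nat).
Let E u := insert vins ins 0 u.

(** Bounds the drop in log length caused by one more letter and a possible insertion; the sum over
    all letters dominates each single one. *)
Definition block_cost := - wsum lnr vins - \sum_j lnr j.

Lemma block_cost_ge0 : 0 <= block_cost.
Proof.
have v0 : wsum lnr vins <= 0 by apply: wsum_le0 => h; rewrite ltW ?lnr_lt0.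
have j0 : \sum_j lnr j <= 0 by apply: sumr_le0 => j _; rewrite ltW ?lnr_lt0.
by rewrite /block_cost; lra.
Qed.

Lemma wsum_insert_rcons u j :
  wsum lnr (E u) - block_cost <= wsum lnr (E (rcons u j)) <= wsum lnr (E u) + lnr j.
Proof.
rewrite /E insert_rcons wsum_cat wsum_cons /block_cost.
have v0 : wsum lnr vins <= 0 by apply: wsum_le0 => h; rewrite ltW ?lnr_lt0.
have j0 : \sum_j lnr j <= lnr j.
  by rewrite (bigD1 j)//= gerDl sumr_le0// => h _; rewrite ltW ?lnr_lt0.
have jn := lnr_lt0 j.
by case: ifP => _; rewrite ?wsum_nil; apply/andP; split; lra.
Qed.

Lemma wsum_insert_gap lam u : (forall j, lnr j <= - lam) ->
  wsum lnr (E u) <= - (lam * (size u)%:R).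
Proof.
move=> H; elim/last_ind: u => [|u j IH]; first by rewrite /E /= wsum_nil mulr0 oppr0.
have /andP[_] := wsum_insert_rcons u j; move/le_trans; apply.
by rewrite size_rcons -natr1 mulrDr mulr1 opprD lerD.
Qed.

(** Each branch below [u] is followed until its cylinder has length at most exp D. The stopped words
    have cylinders of comparable length and meet every branch. *)
Fixpoint stop n D u : seq (seq 'I_k) :=
  if n is m.+1 then
    if wsum lnr (E u) <= D then [:: u]
    else flatten [seq stop m D (rcons u j) | j <- enum 'I_k]
  else [:: u].

(** The stopped words cut the tree below [u], so a one-generation inequality passes to them. This
    direction serves Lebesgue measure and the counting of cylinders, the reverse one serves [mu]. *)
Lemma stop_superadditive (G : seq 'I_k -> \bar R) n D u :
  (forall u, \sum_j G (rcons u j) <= G u)%E ->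
  (\sum_(v <- stop n D u) G v <= G u)%E.
Proof.
move=> GS; elim: n u => [|n IH] u /=; first by rewrite big_seq1.
case: ifP => _; first by rewrite big_seq1.
rewrite big_flatten big_map big_enum/=.
by apply: le_trans (GS u); apply: lee_sum => j _; exact: IH.
Qed.

Lemma stop_subadditive (G : seq 'I_k -> \bar R) n D u :
  (forall u, G u <= \sum_j G (rcons u j))%E ->
  (G u <= \sum_(v <- stop n D u) G v)%E.
Proof.
move=> GS; elim: n u => [|n IH] u /=; first by rewrite big_seq1.
case: ifP => _; first by rewrite big_seq1.
rewrite big_flatten big_map big_enum/=.
by apply: le_trans (GS u) _; apply: lee_sum => j _; exact: IH.
Qed.

Lemma stop_ge n D u v : v \in stop n D u -> D - block_cost <= wsum lnr (E u) ->
  D - block_cost <= wsum lnr (E v).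
Proof.
elim: n u => [|n IH] u /=; first by rewrite inE => /eqP ->.
case: ifPn => [_|]; first by rewrite inE => /eqP ->.
rewrite -ltNge => Du /flatten_mapP[j _ /IH] + _; apply.
have /andP[+ _] := wsum_insert_rcons u j; apply: le_trans.
by rewrite lerB// ltW.
Qed.

Lemma stop_le n D u v : v \in stop n D u ->
  wsum lnr (E v) <= D \/ size v = (size u + n)%N.
Proof.
elim: n u => [|n IH] u /=; first by rewrite inE addn0 => /eqP ->; right.
case: ifPn => [uD|_]; first by rewrite inE => /eqP ->; left.
move=> /flatten_mapP[j _ /IH [|]]; first by left.
by rewrite size_rcons addSnnS; right.
Qed.

Lemma stop_path (om : nat -> 'I_k) n D m :
  exists m', mkseq om m' \in stop n D (mkseq om m).
Proof.
elim: n m => [|n IH] m /=; first by exists m; rewrite inE.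
case: ifPn => _; first by exists m; rewrite inE.
have [m' H] := IH m.+1; exists m'.
by apply/flatten_mapP; exists (om m); rewrite ?mem_enum// -mkseqS.
Qed.

Lemma lebesgue_cyl_superadditive (A : set R) u : measurable A ->
  (\sum_j lebesgue_measure (A `&` open_cyl (E (rcons u j))) <=
   lebesgue_measure (A `&` open_cyl (E u)))%E.
Proof.
move=> mA; have mB w : measurable (A `&` open_cyl w).
  by apply: measurableI => //; exact: measurable_realfun.measurable_ball.
rewrite -big_enum/= fsbig_seq ?enum_uniq// -measure_fin_bigcup//;
  [|apply/trivIsetP => i j _ _ ij|move=> j _; exact: mB].
- apply: le_measure; rewrite ?inE//.
  - by apply: fin_bigcup_measurable => // j _; exact: mB.
  - exact: mB.
  move=> y [j _ [+ /open_cylP[x x01 yE]]]; rewrite yE; split=> //.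
  apply/open_cylP; rewrite /E insert_rcons psiw_cat.
  by eexists; last reflexivity; exact: psiw_oo.
- rewrite -subset0 => y [[_ +] [_ +]].
  move=> /open_cylP[x x01 ->] /open_cylP[z z01] /eqP; apply/negP.
  rewrite /E !insert_rcons; apply: psiw_sep => //.
  by case/andP: x01 => /ltW -> /ltW ->.
Qed.

(* [n] is fuel: the tree is cut at depth [n] if it has not stopped before. *)
Definition hits (n : nat) (d : R) (B : set R) : seq (seq 'I_k) :=
  [seq v <- stop n (ln d) [::] |
    `[< exists2 x, 0 <= x <= 1 & B (psiw (E v) x) >]].

(** The quotient of 6 d, the length of a ball of radius 3 d, by d exp(- [block_cost]), the least
    length of a cylinder stopped at scale d. *)
Definition hit_bound := 6 * expR block_cost.

Lemma hits_scale lam n d B v : (forall j, lnr j <= - lam) -> d <= 1 ->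
  - (lam * n%:R) <= ln d ->
  v \in hits n d B -> ln d - block_cost <= wsum lnr (E v) <= ln d.
Proof.
move=> H d1 nd; rewrite mem_filter => /andP[_ vs]; apply/andP; split.
  apply: (stop_ge vs); rewrite /= wsum_nil subr_le0 (le_trans (ln_le0 d1))//.
  exact: block_cost_ge0.
(* A word cut off for lack of fuel has n letters, which already contract by at least the factor
   d. *)
have [//|vn] := stop_le vs; apply: le_trans nd.
by rewrite -[n]add0n -vn wsum_insert_gap.
Qed.

Lemma size_hits lam n d B : (forall j, lnr j <= - lam) -> 0 < d <= 1 ->
  - (lam * n%:R) <= ln d ->
  (forall x y, B x -> B y -> `|x - y| <= d) ->
  (size (hits n d B))%:R <= hit_bound.
Proof.
move=> H /andP[d0 d1] nd Bd.
have [->|/set0P[x0 Bx0]] := eqVneq B set0.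
  rewrite /hits (eq_filter (a2 := pred0)) ?filter_pred0 ?mulr_ge0 ?expR_ge0//.
  by move=> v /=; apply/asboolPn => -[].
pose A := ball x0 (3 * d).
have mA : measurable A by exact: measurable_realfun.measurable_ball.
have AE : lebesgue_measure A = (6 * d)%:E.
  by rewrite lebesgue_measure_ball ?mulr_ge0 ?(ltW d0)// -mulr_natr; congr EFin; ring.
pose G u := lebesgue_measure (A `&` open_cyl (E u)).
have GA u : (G u <= (6 * d)%:E)%E.
  rewrite -AE; apply: le_measure; rewrite ?inE//.
  by apply: measurableI => //; exact: measurable_realfun.measurable_ball.
have Gv v : v \in hits n d B -> ((d * expR (- block_cost))%:E <= G v)%E.
  move=> vh; have /andP[v1 v2] := hits_scale H d1 nd vh.
  have dv : expR (wsum lnr (E v)) <= d by rewrite -[leRHS]lnK ?posrE// ler_expR.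
  have -> : G v = (expR (wsum lnr (E v)))%:E.
    rewrite -lebesgue_open_cyl /G setIidr// => y yv.
    move: vh; rewrite mem_filter => /andP[/asboolP[x x01 Bx] _].
    rewrite /A -ball_normE /=.
    have -> : x0 - y = (x0 - psiw (E v) x) + (psiw (E v) x - y) by ring.
    apply: (@le_lt_trans _ _ (d + d)); last by lra.
    apply: le_trans (ler_normD _ _) _; apply: lerD; first exact: Bd.
    exact: le_trans (open_cyl_diam yv x01) dv.
  by rewrite lee_fin -{1}[d]lnK ?posrE// -expRD ler_expR.
have : (\sum_(v <- hits n d B) (d * expR (- block_cost))%:E <= (6 * d)%:E)%E.
  apply: le_trans (GA [::]).
  apply: le_trans (stop_superadditive n (ln d) [::]
    (fun u => lebesgue_cyl_superadditive u mA)).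
  rewrite [leLHS]big_seq_cond.
  apply: (@le_trans _ _ (\sum_(v <- hits n d B) G v)%E).
    rewrite -big_seq_cond big_seq [leRHS]big_seq; apply: lee_sum => v; exact: Gv.
  rewrite /hits big_filter [leLHS]big_mkcond/=; apply: lee_sum => v _.
  by case: ifP.
rewrite sumEFin lee_fin big_const_seq count_predT iter_addr_0 -[X in X <= _]mulr_natl.
by rewrite mulrCA [6 * d]mulrC ler_pM2l// expRN ler_pdivrMr ?expR_gt0.
Qed.

Lemma hits_path (om : nat -> 'I_k) n d B x : B x ->
  (forall m, exists2 y, 0 <= y <= 1 & x = psiw (E (mkseq om m)) y) ->
  exists m, mkseq om m \in hits n d B.
Proof.
move=> Bx H; have [m mh] := stop_path om n (ln d) 0; exists m.
rewrite mem_filter mh andbT; apply/asboolP.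
by have [y y01 xE] := H m; exists y => //; rewrite -xE.
Qed.

End stopping.

(** * Mass of balls and the upper bound *)

Section self_similar_mass.
Context (p : 'I_k -> R) (p_gt0 : forall j, 0 < p j).
Context {mu : probability (measurableTypeR R) R}.
Context (muS : forall A : set (measurableTypeR R), measurable A ->
    mu A = (\sum_(j < k) (p j)%:E * mu (psi j @^-1` A))%E).
Context (mu01 : mu `[0%R : R, 1%R : R]%classic = 1%E).

Definition lnp (j : 'I_k) := ln (p j).

Lemma expR_lnp j : expR (lnp j) = p j.
Proof. by rewrite /lnp lnK// posrE. Qed.

Lemma measurable_psi_preimage j (A : set (measurableTypeR R)) :
  measurable A -> measurable (psi j @^-1` A : set (measurableTypeR R)).
Proof.
move=> mA.
have mf : measurable_fun [set: measurableTypeR R] (psi j : _ -> measurableTypeR R).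
  have -> : psi j = (fun x => c j * x + psi j 0).
    by apply/funext => x; rewrite -[x in c j * x]subr0 -psiB subrK.
  apply: measurable_realfun.measurable_funD; last exact: measurable_cst.
  apply: measurable_realfun.measurable_funM; last exact: measurable_id.
  exact: measurable_cst.
by have := mf measurableT _ mA; rewrite setTI.
Qed.

Lemma mu_disjoint (A I : set (measurableTypeR R)) : measurable A ->
  measurable I -> mu I = 1%E -> (forall x, I x -> ~ A x) -> mu A = 0%E.
Proof.
move=> mA mI I1 H; have AI : mu (A `|` I) = (mu A + mu I)%E.
  by apply: measureU => //; rewrite -subset0 => x [/[swap]] /H.
have : (mu (A `|` I) <= 1)%E by exact: probability_le1 (measurableU _ _ mA mI).
rewrite AI I1; have : (0 <= mu A)%E by [].
case: (mu A) => [x| |] //; rewrite !lee_fin => x0 x1; congr EFin; lra.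
Qed.

Lemma mu_off01 (A : set (measurableTypeR R)) : measurable A ->
  (forall x, 0 <= x <= 1 -> ~ A x) -> mu A = 0%E.
Proof.
move=> mA H; apply: (mu_disjoint mA _ mu01); first exact: measurable_itv.
by move=> x; rewrite /= in_itv/= => /H.
Qed.

Lemma mu_ge_cyl w (A : set (measurableTypeR R)) : measurable A ->
  (forall x, 0 <= x <= 1 -> A (psiw w x)) -> ((expR (wsum lnp w))%:E <= mu A)%E.
Proof.
elim: w A => [|j w IH] A mA H.
  by rewrite wsum_nil expR0 -mu01; apply: le_measure; rewrite ?inE//.
rewrite muS// (bigD1 j)//= wsum_cons expRD EFinM expR_lnp.
apply: (@le_trans _ _ ((p j)%:E * mu (psi j @^-1` A))%E).
  apply: lee_wpmul2l; first by rewrite lee_fin ltW.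
  by apply: IH => //; exact: measurable_psi_preimage.
rewrite leeDl// sume_ge0// => i _; apply: mule_ge0 => //.
by rewrite lee_fin ltW.
Qed.

(** At each level only one branch of the self-similarity contributes, as the other maps send [0,1]
    off the open cylinder. Openness keeps shared endpoints out of the argument. *)
Lemma mu_le_open_cyl w (A : set (measurableTypeR R)) : measurable A ->
  A `<=` open_cyl w -> (mu A <= (expR (wsum lnp w))%:E)%E.
Proof.
elim: w A => [|j w IH] A mA H.
  by rewrite wsum_nil expR0; exact: probability_le1.
rewrite muS// (bigD1 j)//= big1 ?adde0; last first.
  move=> i ij; rewrite mu_off01 ?mule0//; first exact: measurable_psi_preimage.
  move=> x x01 /= /H /open_cylP[y y01] /= /eqP; apply/negP.
  by apply: psi_sep => //; exact: psiw_oo.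
rewrite wsum_cons expRD EFinM expR_lnp; apply: lee_wpmul2l.
  by rewrite lee_fin ltW.
apply: IH; first exact: measurable_psi_preimage.
move=> x /= /H /open_cylP[y y01] /= /psi_inj ->.
by apply/open_cylP; exists y.
Qed.

Lemma measurable_psiw_preimage w (A : set (measurableTypeR R)) :
  measurable A -> measurable (psiw w @^-1` A : set (measurableTypeR R)).
Proof.
elim: w A => //= j w IH A mA.
exact: IH (measurable_psi_preimage j mA).
Qed.

(** The self-similarity is expanded down to the stopped words; a word whose closed cylinder misses
    [A] contributes nothing, any other at most its probability. *)
Lemma mu_le_hits n d (A : set (measurableTypeR R)) : measurable A ->
  (mu A <= \sum_(v <- hits [::] xpred0 n d A) (expR (wsum lnp v))%:E)%E.
Proof.
move=> mA; pose G w := ((expR (wsum lnp w))%:E * mu (psiw w @^-1` A))%E.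
have GS u : (G u <= \sum_j G (rcons u j))%E.
  rewrite /G muS; last exact: measurable_psiw_preimage.
  rewrite ge0_sume_distrr; last by move=> j _; rewrite mule_ge0// lee_fin ltW.
  apply: lee_sum => j _; rewrite muleA wsum_rcons expRD EFinM expR_lnp.
  suff -> : psi j @^-1` (psiw u @^-1` A) = psiw (rcons u j) @^-1` A by [].
  by apply/seteqP; split => x /=; rewrite -cats1 psiw_cat.
apply: (@le_trans _ _ (G [::])); first by rewrite /G wsum_nil expR0 mul1e.
apply: le_trans (stop_subadditive [::] xpred0 n (ln d) [::] GS) _.
rewrite /hits big_filter [leRHS]big_mkcond/=; apply: lee_sum => v _.
rewrite insert_none; case: asboolP => [_|H].
  by rewrite /G -[leRHS]mule1 lee_pmul2l ?lte_fin ?expR_gt0// probability_le1//;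
     exact: measurable_psiw_preimage.
rewrite /G mu_off01 ?mule0//; first exact: measurable_psiw_preimage.
by move=> x x01 Ax; apply: H; exists x.
Qed.

Lemma lnr_cost w : - (block_cost [::] * (size w)%:R) <= wsum lnr w.
Proof.
rewrite -mulNr -wsum_const; apply: wsum_le => j.
rewrite /block_cost wsum_nil oppr0 sub0r opprK (bigD1 j)//= gerDl.
by apply: sumr_le0 => i _; rewrite ltW ?lnr_lt0.
Qed.

(** The first term pays for the number of cylinders that share the ball, the second for replacing
    log r by the log length of the chosen cylinder. *)
Definition coarse_const (a : R) :=
  ln (hit_bound [::]) + `|a| * (block_cost [::] + ln 2).

(* A ball B(t, r) with mass at least r^a meets boundedly many cylinders of size
   comparable to r, one of which carries a fixed share of that mass. *)
Lemma coarse_words t a N : (lower_local_dim mu t < a%:E)%E ->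
  exists w, [/\ (N <= size w)%N,
    a * wsum lnr w <= wsum lnp w + coarse_const a &
    exists2 x, 0 <= x <= 1 &
      `|psiw w x - t| <= expR (block_cost [::]) * expR (wsum lnr w)].
Proof.
move=> ta; have [lam lam0 lamH] := finite_gap lnr_lt0.
have bc0 := block_cost_ge0 [::].
(* One letter shrinks by at most exp(- [block_cost]), so a cylinder stopped at scale 2 r with r < d0
   has at least N letters. *)
pose d0 := expR (- (block_cost [::] * N%:R)) / 4.
have d00 : 0 < d0 by rewrite divr_gt0 ?expR_gt0.
have [r /andP[r0 rd] fr] := limf_einf_right_lt ta d00.
have e1 : expR (- (block_cost [::] * N%:R)) <= 1.
  by rewrite expR_le1 oppr_le0 mulr_ge0.
have r1 : r < 1 by rewrite (lt_trans rd)// /d0; lra.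
pose d := 2 * r; have d_gt0 : 0 < d by rewrite mulr_gt0.
have d1 : d <= 1 by move: rd; rewrite /d /d0; lra.
have ln2 := @ln2_ge0 R.
have lnd : ln d = ln 2 + ln r by rewrite /d lnM ?posrE.
have [n nd] : exists n, - (lam * n%:R) <= ln d.
  have [n /(_ n (leqnn _))] := expR_decay ltr01 lam0 d_gt0.
  by rewrite mul1r -[X in _ <= X]lnK ?posrE// ler_expR => nd; exists n.
have mball : measurable (ball t r : set (measurableTypeR R)).
  exact: measurable_realfun.measurable_ball.
have mub : (0 <= mu (ball t r) <= 1)%E by rewrite measure_ge0 probability_le1.
have fr' : ((expR (a * ln r))%:E < mu (ball t r))%E.
  by rewrite ltNge -le_log_ratio ?r0// -ltNge.
pose V := hits [::] xpred0 n d (ball t r).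
have VS : (size V)%:R <= hit_bound [::].
  apply: size_hits lamH _ nd _; first by rewrite d_gt0.
  move=> x y; rewrite -ball_normE /= => xt yt.
  have -> : x - y = (t - y) - (t - x) by ring.
  by apply: le_trans (ler_normB _ _) _; rewrite /d; lra.
have HB : 0 < hit_bound [::] by rewrite mulr_gt0 ?expR_gt0.
(* Pigeonhole: at most [hit_bound] cylinders together carry the mass of the ball. *)
have [v vV av] : exists2 v, v \in V &
    expR (a * ln r) <= hit_bound [::] * expR (wsum lnp v).
  apply: contrapT => H; have := lt_le_trans fr' (mu_le_hits n d mball).
  rewrite sumEFin lte_fin ltNge => /negP; apply.
  rewrite -(ler_pM2l HB) mulr_sumr.
  apply: (@le_trans _ _ (\sum_(v <- V) expR (a * ln r))).
    rewrite big_seq [leRHS]big_seq; apply: ler_sum => v vV.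
    by rewrite leNgt; apply/negP => /ltW av; apply: H; exists v.
  rewrite big_const_seq count_predT iter_addr_0 -[X in X <= _]mulr_natl.
  by rewrite ler_wpM2r ?expR_ge0.
have := hits_scale lamH d1 nd vV; rewrite insert_none => /andP[v1 v2].
exists v; split.
- have : wsum lnr v < - (block_cost [::] * N%:R).
    apply: (le_lt_trans v2); rewrite -ltr_expR lnK ?posrE//.
    by move: rd; rewrite /d /d0; have := expR_gt0 (- (block_cost [::] * N%:R)); lra.
  move/(le_lt_trans (lnr_cost v)); rewrite ltrN2 => H.
  rewrite leqNgt; apply/negP => vN; move: H; rewrite ltNge => /negP; apply.
  by rewrite ler_wpM2l// ler_nat ltnW.
- have : a * ln r <= ln (hit_bound [::]) + wsum lnp v.
    by rewrite -ler_expR expRD lnK.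
  have : a * (wsum lnr v - ln r) <= `|a| * (block_cost [::] + ln 2).
    apply: le_trans (ler_norm _) _; rewrite normrM ler_wpM2l// ler_norml.
    by apply/andP; split; lra.
  by rewrite /coarse_const mulrBr; lra.
- move: vV; rewrite mem_filter insert_none => /andP[/asboolP[x x01 + _]].
  rewrite -ball_normE /= => tx; exists x => //; rewrite distrC (le_trans (ltW tx))//.
  apply: (@le_trans _ _ d); first by rewrite /d; lra.
  by rewrite -expRD -[leLHS]lnK ?posrE// ler_expR; lra.
Qed.

(** A cylinder containing t lies in the ball about t of twice its length, and small balls have mass
    below r^a. The factor 2 costs at most |a| log 2. *)
Lemma fine_words t a N : (a%:E < lower_local_dim mu t)%E ->
  (forall n, exists2 w, size w = n & exists2 x, 0 <= x <= 1 & psiw w x = t) ->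
  exists w, [/\ (N <= size w)%N,
    wsum lnp w <= a * wsum lnr w + `|a| * ln 2 &
    exists2 x, 0 <= x <= 1 & psiw w x = t].
Proof.
move=> ta code; have [lam lam0 lamH] := lnr_gap.
have [d0 d00 fd] := limf_einf_right_gt ta.
have m0 : 0 < Num.min d0 1 / 2 by rewrite divr_gt0// lt_min d00 ltr01.
have [n0 n0H] := expR_decay (ltr0Sn R 1) lam0 m0.
have [w wn [x x01 wx]] := code (maxn N n0).
exists w; split; [by rewrite wn leq_maxl| |by exists x].
have ln2 := @ln2_ge0 R.
pose r := 2 * expR (wsum lnr w).
have r0 : 0 < r by rewrite mulr_gt0 ?expR_gt0.
have rm : r <= Num.min d0 1 / 2.
  apply: le_trans (n0H (size w) _); last by rewrite wn leq_maxr.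
  by rewrite ler_pM2l// ler_expR.
have md : Num.min d0 1 <= d0 by rewrite ge_min lexx.
have m1 : Num.min d0 1 <= 1 by rewrite ge_min lexx orbT.
have mp : 0 < Num.min d0 1 by rewrite lt_min d00 ltr01.
have rd : 0 < r < d0 by rewrite r0; lra.
have r1 : 0 < r < 1 by rewrite r0; lra.
have mball : measurable (ball t r : set (measurableTypeR R)).
  exact: measurable_realfun.measurable_ball.
have mub : (0 <= mu (ball t r) <= 1)%E by rewrite measure_ge0 probability_le1.
have : ((expR (wsum lnp w))%:E < (expR (a * ln r))%:E)%E.
  apply: (@le_lt_trans _ _ (mu (ball t r))); last first.
    by have := fd _ rd; rewrite ltNge log_ratio_le// -ltNge.
  apply: mu_ge_cyl => // y y01; rewrite -ball_normE /= -wx psiw_dist /r.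
  rewrite mulrC ltr_pM2r ?expR_gt0// ltr_norml.
  by move: x01 y01 => /andP[? ?] /andP[? ?]; apply/andP; split; lra.
rewrite lte_fin ltr_expR /r lnM ?posrE ?expR_gt0// expRK mulrDr => H.
have : a * ln 2 <= `|a| * ln 2 by rewrite ler_wpM2r// ler_norm.
by lra.
Qed.

Lemma expR_wsum g w : expR (wsum g w) = \prod_(j <- w) expR (g j).
Proof. by rewrite /wsum expR_sum. Qed.

(** The points served by a word form a set of diameter comparable to its cylinder, and the gauge of
    that set is at most a constant times the product of the [h j]. The extra exponent e pushes the
    sum of the [h j] below 1, so the long words contribute a geometric tail. *)
Lemma hausdorff_measure_limsup_words (E : set R) (q b s0 K D e : R) :
  \sum_j expR (q * lnp j + b * lnr j) <= 1 -> 0 < e -> 0 <= s0 + e -> 0 <= D ->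
  (forall t N, E t -> exists w, [/\ (N <= size w)%N,
     s0 * wsum lnr w <= q * wsum lnp w + b * wsum lnr w + K &
     exists2 x, 0 <= x <= 1 & `|psiw w x - t| <= D * expR (wsum lnr w)]) ->
  hausdorff_measure (s0 + e) E = 0%E.
Proof.
move=> sum1 e0 s0e D0 HE; have [lam lam0 lamH] := finite_gap lnr_lt0.
set s := s0 + e in s0e *.
(* The cylinder itself, enlarged by D times its length on both sides. *)
pose D' := 1 + 2 * D; have D'0 : 0 < D' by rewrite /D'; lra.
pose h j := expR (q * lnp j + (b + e) * lnr j).
pose th := expR (- (e * lam)).
have el0 : 0 < e * lam by rewrite mulr_gt0.
have th01 : 0 < th < 1 by rewrite expR_gt0 expR_lt1 oppr_lt0.
have hth : \sum_j h j <= th.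
  apply: (@le_trans _ _ (\sum_j expR (q * lnp j + b * lnr j) * th)).
    apply: ler_sum => j _; rewrite -expRD ler_expR mulrDl addrA lerD2l.
    by rewrite -mulrN ler_pM2l.
  by rewrite -mulr_suml ler_piMl// ltW; case/andP: th01.
pose C := expR (s * ln D' + K).
apply: hausdorff_measure_eq0 => d eps d0 eps0.
have [N1 N1H] := expR_decay D'0 lam0 d0.
have [N2 N2H] : exists N0, forall N, (N0 <= N)%N -> C * (th ^+ N / (1 - th)) <= eps.
  have C1 : 0 < C / (1 - th) by rewrite divr_gt0 ?expR_gt0 ?subr_gt0//; case/andP: th01.
  have [N0 N0H] := expR_decay C1 el0 eps0; exists N0 => N /N0H; apply: le_trans.
  by rewrite -mulNr expRM_natr -/th mulrCA mulrC.
pose N := maxn N1 N2.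
pose U w : set R := [set t | [/\ (N <= size w)%N,
  s0 * wsum lnr w <= q * wsum lnp w + b * wsum lnr w + K &
  exists2 x, 0 <= x <= 1 & `|psiw w x - t| <= D * expR (wsum lnr w)]].
have Udiam w : (diam (U w) <= (D' * expR (wsum lnr w))%:E)%E.
  apply: diam_le => y z [_ _ [x x01 xy]] [_ _ [x' x'01 xz]].
  have -> : y - z = (psiw w x - psiw w x') - (psiw w x - y) + (psiw w x' - z) by ring.
  apply: le_trans (ler_normD _ _) _; apply: (le_trans (lerD (ler_normB _ _) xz)).
  rewrite psiw_dist /D'.
  have : expR (wsum lnr w) * `|x - x'| <= expR (wsum lnr w).
    rewrite ler_piMr ?expR_ge0// ler_norml.
    by move: x01 x'01 => /andP[? ?] /andP[? ?]; apply/andP; split; lra.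
  by rewrite mulrDl mul1r; lra.
have Ugauge w : (gauge s (U w) <=
    (if (N <= size w)%N then C * \prod_(j <- w) h j else 0)%:E)%E.
  have [->|/set0P [t [Nw sw _]]] := eqVneq (U w) set0.
    rewrite gauge_set0 lee_fin; case: ifP => // _.
    by rewrite mulr_ge0 ?expR_ge0// prodr_ge0// => j _; exact: expR_ge0.
  rewrite Nw; apply: le_trans (gauge_le _ _ (Udiam w)) _ => //.
    by rewrite mulr_ge0 ?expR_ge0// ltW.
  rewrite lee_fin /powR gt_eqF ?mulr_gt0 ?expR_gt0// lnM ?posrE ?expR_gt0// expRK.
  rewrite -expR_wsum -expRD ler_expR wsumD !wsumZ.
  by rewrite mulrDr /s !mulrDl; lra.
have Nd w : (N <= size w)%N -> D' * expR (wsum lnr w) <= d.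
  move=> Nw; apply: le_trans (N1H (size w) _); last exact: leq_trans (leq_maxl _ _) Nw.
  rewrite ler_pM2l// ler_expR -mulNr -wsum_const; exact: wsum_le.
apply: (hausdorff_premeasure_countable (U := U)); first exact: ltW.
- by move=> t Et; have [w Hw] := HE t N Et; exists w.
- move=> w; have [->|/set0P [t [Nw _ _]]] := eqVneq (U w) set0.
    by apply: diam_le => // ? ? [].
  by apply: le_trans (Udiam w) _; rewrite lee_fin Nd.
- move=> X uX; apply: (@le_trans _ _ (\sum_(w <- X)
    (if (N <= size w)%N then C * \prod_(j <- w) h j else 0)%:E)%E).
    by apply: lee_sum => w _; exact: Ugauge.
  rewrite sumEFin lee_fin -big_mkcond/= -big_filter -mulr_sumr.
  apply: le_trans (N2H N (leq_maxr _ _)); rewrite ler_pM2l ?expR_gt0//.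
  apply: sum_long_words => //; first by move=> j; exact: expR_ge0.
    exact: filter_uniq.
  by move=> w; rewrite mem_filter => /andP[].
Qed.

(** * The range of the lower local dimension, and the upper bound for the level sets *)

Section attractor.
Context {F : set R} (F01 : F `<=` `[0, 1]%classic) (Fcompact : compact F).
Context (FS : F = \bigcup_j (psi j @` F)) (muF : mu F = 1%E).

Lemma attractor_code t n : F t ->
  exists2 w, size w = n & exists2 x, 0 <= x <= 1 & psiw w x = t.
Proof.
suff H : F t -> exists2 w, size w = n & exists2 x, F x & psiw w x = t.
  move=> /H[w wn [x Fx wx]]; exists w => //; exists x => //.
  by have := F01 Fx; rewrite /= in_itv.
elim: n t => [|n IH] t Ft; first by exists [::] => //; exists t.
move: Ft; rewrite {1}FS => -[j _ [y /IH[w wn [x Fx wx]] yt]].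
by exists (j :: w); [rewrite /= wn|exists x => //=; rewrite wx].
Qed.

(** Small balls about t miss the closed set F and are null. Hence every point of finite lower
    dimension lies in F and has a code. *)
Lemma lower_local_dim_off t : ~ F t -> lower_local_dim mu t = +oo%E.
Proof.
move=> Ft; apply/eqP; rewrite eq_le leey /=.
have Fc : closed F by apply: compact_closed => //; exact: Rhausdorff.
have /nbhs_ballP[e e0 eF] : nbhs t (~` F).
  by apply: open_nbhs_nbhs; split => //; exact: closed_openC.
apply: (@limf_einf_right_ge _ _ _ (Num.min e 1)); first by rewrite lt_min e0 ltr01.
move=> r /andP[r0]; rewrite lt_min => /andP[re r1].
rewrite (mu_disjoint _ _ muF).
- by rewrite le0_lneNy// lt0_mulNye// lte_fin invr_lt0 ln_lt0// r0.
- exact: measurable_realfun.measurable_ball.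
- exact: measurable_realfun.closed_measurable.
- by move=> x Fx /(le_ball (ltW re))/eF.
Qed.

(** If every [g j] were positive, [wsum g w] would grow at a fixed linear rate in the length of [w].
    For small e the right side grows at most at half that rate, and [K e] does not depend on N. *)
Lemma exists_letter_le0 (g : 'I_k -> R) (K : R -> R) :
  (forall e N, 0 < e -> exists2 w, (N <= size w)%N &
     wsum g w <= K e - e * wsum lnr w) ->
  exists j, g j <= 0.
Proof.
move=> H; apply: contrapT => /forallNP gj.
have [lam lam0 lamH] : exists2 lam, 0 < lam & forall j, - g j <= - lam.
  by apply: finite_gap => j; rewrite oppr_lt0 ltNge; apply/negP.
have bc := block_cost_ge0 [::].
have l20 : 0 < lam / 2 by rewrite divr_gt0.
have [e e0 eb] := small_factor bc l20.
have [w Nw] := H e (Num.bound (`|K e| / (lam / 2))) e0.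
have Kb : `|K e| < lam / 2 * (size w)%:R.
  rewrite -ltr_pdivrMl// mulrC; apply: lt_le_trans (archi_boundP _) _.
    by rewrite divr_ge0// ltW.
  by rewrite ler_nat.
have gw : lam * (size w)%:R <= wsum g w.
  by rewrite -wsum_const; apply: wsum_le => j; rewrite -lerN2.
have ew : - (e * wsum lnr w) <= lam / 2 * (size w)%:R.
  rewrite -mulrN; apply: (@le_trans _ _ (e * (block_cost [::] * (size w)%:R))).
    by rewrite ler_pM2l// lerNl lnr_cost.
  by rewrite mulrA ler_wpM2r.
have := ler_norm (K e).
lra.
Qed.

(** Coarse words rule out that all ratios log p_j / log r_j exceed alpha, fine words that all lie
    below it. *)
Lemma lower_local_dim_range alpha t : lower_local_dim mu t = alpha%:E ->
  (exists j, alpha * lnr j <= lnp j) /\ (exists j, lnp j <= alpha * lnr j).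
Proof.
move=> ta; have Ft : F t by apply: contrapT => /lower_local_dim_off; rewrite ta.
split.
- have [j jH] : exists j, alpha * lnr j + - 1 * lnp j <= 0; last by exists j; lra.
  apply: (exists_letter_le0 (K := fun e => coarse_const (alpha + e))) => e N e0.
  have [|w [Nw wH _]] := @coarse_words t (alpha + e) N.
    by rewrite ta lte_fin ltrDl.
  by exists w => //; rewrite wsumD !wsumZ; lra.
- have [j jH] : exists j, lnp j + - alpha * lnr j <= 0; last by exists j; lra.
  apply: (exists_letter_le0 (K := fun e => `|alpha - e| * ln 2)) => e N e0.
  have [||w [Nw wH _]] := @fine_words t (alpha - e) N.
  + by rewrite ta lte_fin ltrBlDr ltrDl.
  + by move=> n; exact: attractor_code.
  by exists w => //; rewrite wsumD !wsumZ; lra.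
Qed.

Lemma hausdorff_dim_level_le alpha q b :
  \sum_j expR (q * lnp j + b * lnr j) <= 1 -> 0 <= alpha * q + b ->
  (hausdorff_dim (lower_level_set mu alpha) <= (alpha * q + b)%:E)%E.
Proof.
move=> sum1 s0; apply/lee_addgt0Pr => eta eta0; rewrite -EFinD.
have eta20 : 0 < eta / 2 by rewrite divr_gt0.
have [e e0] := small_factor (normr_ge0 q) eta20; rewrite mulrC => qe.
apply: hausdorff_dim_le; first lra.
(* A lower bound on q log p_w is wanted: for q >= 0 it comes from the lower bound on p_w along
   coarse words, for q < 0 from the upper bound along fine words. *)
have [q0|q0] := leP 0 q.
- rewrite ger0_norm// in qe.
  have -> : alpha * q + b + eta = ((alpha + e) * q + b) + (eta - q * e) by ring.
  apply: (@hausdorff_measure_limsup_words _ q b _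
    (q * coarse_const (alpha + e)) (expR (block_cost [::]))) => //.
  + lra.
  + lra.
  move=> t N [_ ta]; have [|w [Nw wH wt]] := @coarse_words t (alpha + e) N.
    by rewrite ta lte_fin ltrDl.
  exists w; split => //.
  have := ler_wpM2l q0 wH; rewrite mulrDl !mulrDr mulrA; lra.
- rewrite ltr0_norm// in qe.
  have -> : alpha * q + b + eta = ((alpha - e) * q + b) + (eta + q * e) by ring.
  apply: (@hausdorff_measure_limsup_words _ q b _
    (- q * (`|alpha - e| * ln 2)) 0) => //.
  + lra.
  + lra.
  move=> t N [_ ta]; have [||w [Nw wH [x x01 wx]]] := @fine_words t (alpha - e) N.
  + by rewrite ta lte_fin ltrBlDr ltrDl.
  + move=> n; apply: attractor_code.
    by apply: contrapT => /lower_local_dim_off; rewrite ta.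
  exists w; split => //; last by exists x => //; rewrite wx subrr normr0 mul0r.
  have := ler_wnM2l (ltW q0) wH; rewrite mulrDl !mulrDr mulrA; lra.
Qed.

End attractor.

(** * The tilted measure and the lower bound *)

(* With the tilt q = - 2 eta S, the sum of the q x_j along a word telescopes up to
   squares, as 2 S x_j = (S + x_j)^2 - S^2 - x_j^2; this yields the Gaussian factor
   in S, and the squares are absorbed by half of l. *)
Lemma tilted_tree_measure (g x : 'I_k -> R) (l : R) : 0 < l ->
  (forall q, expR l <= \sum_j expR (g j + q * x j)) ->
  exists (eta : R) (nu : seq 'I_k -> R),
    [/\ 0 < eta, forall w, 0 <= nu w, nu [::] = 1,
        forall w, \sum_j nu (rcons w j) = nu w &
        forall w, nu w <=
          expR (wsum g w - eta * (wsum x w) ^+ 2 - l / 2 * (size w)%:R)].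
Proof.
move=> l0 fl; pose f q := \sum_j expR (g j + q * x j).
have f0 q : 0 < f q by apply: lt_le_trans (fl q); exact: expR_gt0.
have x20 : 0 <= \sum_j x j ^+ 2 by apply: sumr_ge0 => j _; exact: sqr_ge0.
have [e e0 eX] := small_factor x20 (divr_gt0 l0 (ltr0Sn R 1)).
have ex j : e * x j ^+ 2 <= l / 2.
  apply: le_trans eX; rewrite ler_pM2l// (bigD1 j)//= lerDl.
  by apply: sumr_ge0 => i _; exact: sqr_ge0.
pose W S j := expR (g j + (- (2 * e * S)) * x j) / f (- (2 * e * S)).
pose step (st : R * R) j := (st.1 + x j, st.2 * W st.1 j).
pose nu w := (foldl step (0, 1) w).2.
have S1 w : (foldl step (0, 1) w).1 = wsum x w.
  elim/last_ind: w => [|w j IH]; first by rewrite wsum_nil.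
  by rewrite foldl_rcons wsum_rcons /= IH.
have nu_rcons w j : nu (rcons w j) = nu w * W (wsum x w) j.
  by rewrite /nu foldl_rcons /= S1.
have W0 S j : 0 <= W S j by rewrite divr_ge0 ?expR_ge0// ltW.
have WS S : \sum_j W S j = 1 by rewrite -mulr_suml divff// gt_eqF// f0.
have nu0 w : 0 <= nu w.
  by elim/last_ind: w => [|w j IH]; [exact: ler01|rewrite nu_rcons mulr_ge0].
exists e, nu; split => // [w|w].
  under eq_bigr do rewrite nu_rcons.
  by rewrite -mulr_sumr WS mulr1.
elim/last_ind: w => [|w j IH].
  by rewrite !wsum_nil expr0n/= !mulr0 !subr0 expR0.
rewrite nu_rcons; apply: (le_trans (ler_pM (nu0 w) (W0 _ _) IH (lexx _))).
rewrite /W; apply: (@le_trans _ _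
  (expR (wsum g w - e * wsum x w ^+ 2 - l / 2 * (size w)%:R) *
  (expR (g j + (- (2 * e * wsum x w)) * x j) / expR l))).
  by rewrite ler_pM2l ?expR_gt0// ler_pM2l ?expR_gt0// lef_pV2 ?posrE ?f0 ?expR_gt0// fl.
rewrite -expRB -expRD ler_expR !wsum_rcons size_rcons -[(size w).+1%:R]natr1.
have := ex j; lra.
Qed.

(** * Words with insertions, and the points coded by infinite paths *)

Section insertion.
Context (vins : seq 'I_k).
Let E u := insert vins after_square 0 u.

(** There is one insertion for each positive square up to the length of [u]. *)
Lemma wsum_insert g u :
  wsum g (E u) = wsum g u + (isqrt (size u))%:R * wsum g vins.
Proof.
elim/last_ind: u => [|u j IH]; first by rewrite /E /= !wsum_nil mul0r addr0.
rewrite /E insert_rcons wsum_cat -/(E u) IH wsum_cons wsum_rcons size_rcons isqrtS.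
rewrite add0n natrD; case: (after_square _); rewrite ?wsum_nil /=; ring.
Qed.

Lemma insert_cat u u' : exists v, E (u ++ u') = E u ++ v.
Proof.
elim/last_ind: u' => [|u' j [v IH]]; first by exists [::]; rewrite !cats0.
by rewrite -rcons_cat /E insert_rcons -/(E _) IH -catA; eexists.
Qed.

Lemma insert_mkseq_prefix (om : nat -> 'I_k) m n : (m <= n)%N ->
  exists v, E (mkseq om n) = E (mkseq om m) ++ v.
Proof.
move=> mn; rewrite -(subnKC mn) /mkseq iotaD map_cat.
exact: insert_cat.
Qed.

Lemma psiw_between w y : 0 <= y <= 1 ->
  Num.min (psiw w 0) (psiw w 1) <= psiw w y <= Num.max (psiw w 0) (psiw w 1).
Proof.
move=> /andP[y0 y1]; have [s _ H] := psiw_slope w.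
have y1' : 0 <= 1 - y by rewrite subr_ge0.
have E0 := H y 0; have E1 := H 1 y; rewrite subr0 in E0; rewrite ge_min le_max.
have [s0|/ltW s0] := leP 0 s.
  have := mulr_ge0 s0 y0; have := mulr_ge0 s0 y1'; rewrite -E0 -E1 !subr_ge0.
  by move=> -> ->; rewrite orbT.
have := mulr_le0_ge0 s0 y0; have := mulr_le0_ge0 s0 y1'; rewrite -E0 -E1 !subr_le0.
by move=> -> ->; rewrite orbT.
Qed.

Lemma psiw_between_inv w x :
  Num.min (psiw w 0) (psiw w 1) <= x <= Num.max (psiw w 0) (psiw w 1) ->
  exists2 y, 0 <= y <= 1 & x = psiw w y.
Proof.
have [s sE H] := psiw_slope w.
have s0 : s != 0 by rewrite -normr_gt0 sE expR_gt0.
have E1 := H 1 0; rewrite subr0 mulr1 in E1.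
have -> : psiw w 1 = psiw w 0 + s by lra.
move=> xb; exists ((x - psiw w 0) / s); last first.
  have := H ((x - psiw w 0) / s) 0; rewrite subr0 [s * _]mulrC divfK//.
  by move=> /addIr ->.
move: s0; rewrite neq_lt => /orP[sn|sp].
  rewrite ler_ndivlMr// mul0r ler_ndivrMr// mul1r.
  move: xb; rewrite min_r ?max_l; lra.
rewrite ler_pdivlMr// mul0r ler_pdivrMr// mul1r.
move: xb; rewrite min_l ?max_r; lra.
Qed.

(** Nested intervals: of two cylinders along the path the deeper lies in both, so every left end is
    at most every right end. The supremum of the left ends is the point. *)
Lemma path_point (om : nat -> 'I_k) :
  exists t, forall n, exists2 y, 0 <= y <= 1 & t = psiw (E (mkseq om n)) y.
Proof.
pose w n := E (mkseq om n).
pose lo n := Num.min (psiw (w n) 0) (psiw (w n) 1).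
pose hi n := Num.max (psiw (w n) 0) (psiw (w n) 1).
have in01 : 0 <= (0 : R) <= 1 by rewrite lexx ler01.
have cross m n : exists x, lo m <= x <= hi m /\ lo n <= x <= hi n.
  have [u wu] := insert_mkseq_prefix om (leq_maxl m n).
  have [v wv] := insert_mkseq_prefix om (leq_maxr m n).
  exists (psiw (w (maxn m n)) 0); split.
    by rewrite /w wu psiw_cat; apply: psiw_between; exact: psiw01.
  by rewrite /w wv psiw_cat; apply: psiw_between; exact: psiw01.
have lohi m n : lo m <= hi n.
  by have [x [/andP[x1 _] /andP[_ x2]]] := cross m n; exact: le_trans x1 x2.
exists (sup (range lo)) => n; apply: psiw_between_inv; apply/andP; split.
  apply: ub_le_sup; last by exists n.
  by exists (hi 0%N) => _ [m _ <-]; exact: lohi.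
apply: ge_sup; first by exists (lo 0%N), 0%N.
by move=> _ [m _ <-]; exact: lohi.
Qed.

End insertion.

(** * Local dimension at the points coded by pruned paths *)

Section level_points.
Context {vins : seq 'I_k} {c0 : R} (c00 : 0 < c0).
Context (core : forall x, 0 <= x <= 1 -> c0 <= psiw vins x <= 1 - c0).
Let E u := insert vins after_square 0 u.

(** After the inserted word a point is at distance at least c0 r_w from both ends of the cylinder of
    [w]. *)
Lemma ball_core_sub w z r : 0 <= z <= 1 -> r <= c0 * expR (wsum lnr w) ->
  ball (psiw (w ++ vins) z) r `<=` open_cyl w.
Proof.
move=> z01 rc y; rewrite /open_cyl -ball_normE /= psiw_cat => yb.
have -> : psiw w (1 / 2) - y = (psiw w (1 / 2) - psiw w (psiw vins z)) +
   (psiw w (psiw vins z) - y) by ring.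
apply: le_lt_trans (ler_normD _ _) _; rewrite psiw_dist.
have : `|1 / 2 - psiw vins z| <= 1 / 2 - c0.
  have /andP[? ?] := core z01; rewrite ler_norml; apply/andP; split; lra.
move/(ler_wpM2l (expR_ge0 (wsum lnr w))); lra.
Qed.

Context {alpha L : R} (L1 : 1 <= L) {om : nat -> 'I_k} {t : R}.
Let x j := lnp j - alpha * lnr j.
Context (omL : forall n, wsum x (mkseq om n) ^+ 2 <= L * n.+1%:R).
Context (tE : forall n, exists2 y, 0 <= y <= 1 & t = psiw (E (mkseq om n)) y).
Let rho n := wsum lnr (E (mkseq om n)).
Let K1 := L + `|wsum x vins|.

(** Pruning bounds the sum along the path by the root of L (n + 1), hence by L ([isqrt n] + 1) since
    L >= 1; the insertions add [isqrt n] copies of the sum along [vins]. *)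
Lemma drift_bound n :
  `|wsum lnp (E (mkseq om n)) - alpha * rho n| <= K1 * ((isqrt n)%:R + 1).
Proof.
have -> : wsum lnp (E (mkseq om n)) - alpha * rho n = wsum x (E (mkseq om n)).
  have -> : x = (fun j => lnp j + (- alpha) * lnr j).
    by apply/funext => j; rewrite /x mulNr.
  by rewrite wsumD wsumZ mulNr.
rewrite wsum_insert size_mkseq /K1 mulrDl.
apply: le_trans (ler_normD _ _) _; apply: lerD; last first.
  by rewrite normrM ger0_norm// mulrC ler_wpM2l// lerDl.
have L0 : 0 <= L := le_trans ler01 L1.
rewrite -ler_sqr ?nnegrE ?mulr_ge0 ?addr_ge0// real_normK ?num_real//.
apply: le_trans (omL n) _; rewrite exprMn.
apply: (@le_trans _ _ (L * ((isqrt n)%:R + 1) ^+ 2)).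
  rewrite ler_wpM2l// natr1 -natrX ler_nat.
  by case/andP: (isqrtP n).
by rewrite ler_wpM2r ?sqr_ge0// expr2 ler_peMl.
Qed.

Lemma rho_decay lam n : (forall j, lnr j <= - lam) -> rho n <= - (lam * n%:R).
Proof.
move=> H; have := wsum_insert_gap vins after_square (mkseq om n) H.
by rewrite size_mkseq.
Qed.

Lemma rho_anti m n : (m <= n)%N -> rho n <= rho m.
Proof.
move=> mn; have [v vE] := insert_mkseq_prefix vins om mn.
rewrite /rho /E vE wsum_cat gerDl wsum_le0// => j; exact: ltW (lnr_lt0 j).
Qed.

Lemma rho_lipschitz m d : rho m - block_cost vins * d%:R <= rho (m + d).
Proof.
elim: d => [|d IH]; first by rewrite mulr0 subr0 addn0.
have /andP[+ _] := wsum_insert_rcons vins after_square (mkseq om (m + d)) (om (m + d)).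
rewrite -mkseqS -addnS -/(E _) -/(E _) -/(rho _) -/(rho _) -natr1 mulrDr; lra.
Qed.

(** The ball is compared with the cylinder at the last square depth M = m^2 before its own scale is
    reached, where the insertion keeps the ball inside. Going back to M takes at most 2 (m + 1)
    letters; this and the drift cost O(m), against - log r of order at least m^2. *)
Lemma level_point_lower e : 0 < e ->
  ((alpha - e)%:E <= lower_local_dim mu t)%E.
Proof.
move=> e0; have [lam lam0 lamH] := finite_gap lnr_lt0.
pose B := block_cost vins; have B0 : 0 <= B := block_cost_ge0 vins.
pose Bp := - wsum lnp vins.
pose K2 := K1 + `|Bp| + `|alpha| * (`|ln c0| + 2 * B).
have [m0 m0H] := linear_le_sqr K2 (mulr_gt0 e0 lam0).
have cle1 : c0 < 1.
  have /andP[? ?] := core (x := 0) ltac:(by rewrite lexx ler01); lra.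
have lnc : ln c0 <= 0 by rewrite ln_le0// ltW.
(* Radii below the resulting d have square depth m > m0, where [m0H] applies. *)
pose N := (m0.+1 ^ 2)%N.
pose d := c0 * expR (rho N); have d0 : 0 < d by rewrite mulr_gt0 ?expR_gt0.
have d1 : d < 1.
  rewrite /d (le_lt_trans _ cle1)// ler_piMr ?(ltW c00)// expR_le1.
  apply: wsum_le0 => j; exact: ltW (lnr_lt0 j).
apply: (limf_einf_right_ge d0) => r /andP[r0 rd].
have r1 : r < 1 by exact: lt_trans d1.
have mball : measurable (ball t r : set (measurableTypeR R)).
  exact: measurable_realfun.measurable_ball.
rewrite le_log_ratio ?r0//; last by rewrite measure_ge0 probability_le1.
have lnd : ln d = ln c0 + rho N by rewrite /d lnM ?posrE ?expR_gt0// expRK.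
have rN : ln r < ln c0 + rho N by rewrite -lnd ltr_ln.
have [n0 n0H] : exists n, rho n <= ln r - ln c0.
  have rc0 : 0 < r / c0 by rewrite divr_gt0.
  have [n /(_ n (leqnn _))] := expR_decay ltr01 lam0 rc0.
  rewrite mul1r -[X in _ <= X]lnK ?posrE// ler_expR ln_div ?posrE// => H.
  by exists n; exact: le_trans (rho_decay n lamH) H.
have exn : exists n, rho n <= ln r - ln c0 by exists n0.
case: (ex_minnP exn) => n1 n1H n1min.
have Nn1 : (N < n1)%N.
  rewrite ltnNge; apply/negP => n1N; have := rho_anti n1N; lra.
case: n1 => [//|n] in n1H n1min Nn1 *.
have nH : ln r - ln c0 < rho n.
  by rewrite ltNge; apply/negP => /n1min; rewrite ltnn.
pose m := isqrt n; have /andP[mn nm] := isqrtP n; rewrite -/m in mn nm.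
have m0m : (m0 < m)%N by rewrite /m -(isqrt_sqr m0.+1); apply: isqrt_le.
case Em : m m0m => [//|m'] m0m.
(* Letter M' completes the prefix of length M; [w] is the word just before the insertion that
   follows this letter. *)
pose M := (m ^ 2)%N; pose M' := M.-1.
have MM : M = M'.+1 by rewrite /M' prednK// /M Em expn_gt0.
pose w := rcons (E (mkseq om M')) (om M').
have wE : E (mkseq om M) = w ++ vins.
  rewrite MM mkseqS /E insert_rcons size_mkseq add0n.
  have -> : after_square M' by rewrite /M' /M Em; exact: after_square_sqr.
  by rewrite /w cat_rcons.
have rhoM : rho M = wsum lnr w + wsum lnr vins by rewrite /rho wE wsum_cat.
have v0 : wsum lnr vins <= 0 by apply: wsum_le0 => j; exact: ltW (lnr_lt0 j).
have rhoMn : rho n <= rho M by exact: rho_anti.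
have [z z01 tz] := tE M; rewrite wE in tz.
have bsub : ball t r `<=` open_cyl w.
  rewrite tz; apply: ball_core_sub => //.
  by rewrite -[leLHS]lnK ?posrE// -[c0]lnK ?posrE// -expRD ler_expR; lra.
apply: le_trans (mu_le_open_cyl mball bsub) _; rewrite lee_fin ler_expR.
have drift : wsum lnp w - Bp - alpha * rho M <= K1 * (m%:R + 1).
  have := drift_bound M; rewrite wE wsum_cat /M isqrt_sqr -/M /Bp => H.
  by apply: le_trans H; apply: le_trans (ler_norm _); lra.
have rhoM1 : rho M - B * (2 * (m%:R + 1)) <= rho n.+1.
  have Mn : (M <= n.+1)%N by apply: leqW.
  have := rho_lipschitz M (n.+1 - M); rewrite subnKC// -/B.
  apply: le_trans; rewrite lerD2l lerN2 ler_wpM2l//.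
  rewrite natr1 -natrM ler_nat leq_subLR.
  exact: ltn_sqrS.
have aM : alpha * (rho M - ln r) <= `|alpha| * (`|ln c0| + 2 * B * (m%:R + 1)).
  apply: le_trans (ler_norm _) _; rewrite normrM ler_wpM2l//.
  have c_ := ler_norm (- ln c0); rewrite normrN in c_.
  have : 0 <= B * (m%:R + 1) by rewrite mulr_ge0// addr_ge0.
  move=> Bm; rewrite ler_norml; apply/andP; split; lra.
have er : K2 * (m%:R + 1) <= e * (- ln r).
  apply: le_trans (m0H m _) _; first by rewrite Em ltnW.
  rewrite -mulrA ler_pM2l//; have := rho_decay M lamH; rewrite /M natrX; lra.
have mp : 1 <= m%:R + 1 :> R by rewrite lerDr.
have Bpm : Bp <= `|Bp| * (m%:R + 1).
  by apply: le_trans (ler_norm _) _; rewrite ler_peMr.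
have acm : `|alpha| * `|ln c0| <= `|alpha| * `|ln c0| * (m%:R + 1).
  by rewrite ler_peMr// mulr_ge0.
move: er; rewrite /K2; lra.
Qed.

(** One sequence of radii is enough for a lower limit: twice the cylinder lengths at square depths,
    where the ball contains the cylinder and [isqrt] is exact. *)
Lemma level_point_upper e : 0 < e ->
  (lower_local_dim mu t <= (alpha + e)%:E)%E.
Proof.
move=> e0; have [lam lam0 lamH] := finite_gap lnr_lt0.
have ln2 := @ln2_ge0 R.
pose K2 := K1 + `|alpha + e| * ln 2.
have [m0 m0H] := linear_le_sqr K2 (mulr_gt0 e0 lam0).
apply: limf_einf_right_le => d d0.
have dm : 0 < Num.min d 1 / 2 by rewrite divr_gt0// lt_min d0 ltr01.
have [n0 n0H] := expR_decay (ltr0Sn R 1) lam0 dm.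
pose m := maxn m0 n0; pose M := (m ^ 2)%N.
pose r := 2 * expR (rho M); have r0 : 0 < r by rewrite mulr_gt0 ?expR_gt0.
have rm : r <= Num.min d 1 / 2.
  apply: le_trans (n0H M _); last first.
    rewrite /M (leq_trans (leq_maxr m0 n0))// -/m.
    by case: (m) => // h; rewrite -mulnn leq_pmulr.
  by rewrite ler_pM2l// ler_expR rho_decay.
have md : Num.min d 1 <= d by rewrite ge_min lexx.
have m1 : Num.min d 1 <= 1 by rewrite ge_min lexx orbT.
have mp : 0 < Num.min d 1 by rewrite lt_min d0 ltr01.
have r1 : 0 < r < 1 by rewrite r0; lra.
exists r; first by rewrite r0; lra.
have mball : measurable (ball t r : set (measurableTypeR R)).
  exact: measurable_realfun.measurable_ball.
rewrite log_ratio_le//; last by rewrite measure_ge0 probability_le1.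
apply: (@le_trans _ _ (expR (wsum lnp (E (mkseq om M))))%:E); last first.
  have [z z01 tz] := tE M.
  apply: mu_ge_cyl => // y y01; rewrite -ball_normE /= tz psiw_dist /r.
  rewrite mulrC ltr_pM2r ?expR_gt0// ltr_norml.
  by move: z01 y01 => /andP[? ?] /andP[? ?]; apply/andP; split; lra.
rewrite lee_fin ler_expR /r lnM ?posrE ?expR_gt0// expRK.
have := drift_bound M; rewrite /M isqrt_sqr -/M ler_norml => /andP[dr _].
have er : K2 * (m%:R + 1) <= e * (- rho M).
  apply: le_trans (m0H m (leq_maxl _ _)) _.
  rewrite -mulrA ler_pM2l//; have := rho_decay M lamH; rewrite /M natrX; lra.
have : (alpha + e) * ln 2 <= `|alpha + e| * ln 2 * (m%:R + 1).
  apply: (@le_trans _ _ (`|alpha + e| * ln 2)); first by rewrite ler_wpM2r ?ler_norm.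
  by rewrite ler_peMr ?mulr_ge0// lerDr.
move: er; rewrite /K2; lra.
Qed.

Lemma level_point : lower_level_set mu alpha t.
Proof.
split.
  (* The insertion after the first letter already places t in the open interval (0,1). *)
  have [z z01 ->] := tE 1; rewrite /E /= cats0 -/(after_square 0).
  have : 0 < psiw vins z < 1.
    have c0_gt0 := c00; have /andP[? ?] := core z01; apply/andP; split; lra.
  by move=> H; exact: (psiw_oo [:: om 0%N] H).
apply/eqP; rewrite eq_le; apply/andP; split.
  apply/lee_addgt0Pr => e e0; rewrite -EFinD; exact: level_point_upper.
apply/lee_subgt0Pr => e e0; rewrite -EFinB; exact: level_point_lower.
Qed.

End level_points.

(** A cover of small sum is translated into words: those whose cylinders meet a covering set at its
    own scale. Together with the pruned words they have [nu]-mass below 1, and a path avoiding them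
    all codes a point of the level set that is not covered. *)
Lemma hausdorff_measure_level_neq0 (vins : seq 'I_k) (c0 alpha s s1 : R) :
  (0 < k)%N -> 0 < c0 ->
  (forall x, 0 <= x <= 1 -> c0 <= psiw vins x <= 1 - c0) ->
  0 <= s -> s < s1 ->
  (forall q, 1 <= \sum_j expR (s1 * lnr j + q * (lnp j - alpha * lnr j))) ->
  hausdorff_measure s (lower_level_set mu alpha) <> 0%E.
Proof.
move=> k0 c00 core s0 ss1 f1; have [lam lam0 lamH] := finite_gap lnr_lt0.
(* The gap between t and s1 yields the gain l; the gap between s and t allows a positive scale for
   covering sets of diameter 0. *)
pose t := (s + s1) / 2.
have st : s < t by rewrite /t; lra.
have ts1 : t < s1 by rewrite /t; lra.
have t0 : 0 < t by exact: le_lt_trans st.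
pose x j := lnp j - alpha * lnr j.
have [l l0 lE] : exists2 l, 0 < l & l = lam * (s1 - t).
  by exists (lam * (s1 - t)) => //; rewrite mulr_gt0// subr_gt0.
have fl q : expR l <= \sum_j expR (t * lnr j + q * x j).
  apply: (@le_trans _ _ (expR l * \sum_j expR (s1 * lnr j + q * x j))).
    by rewrite ler_peMr ?expR_ge0// f1.
  rewrite mulr_sumr; apply: ler_sum => j _; rewrite -expRD ler_expR addrA lerD2r.
  have : (s1 - t) * lnr j <= (s1 - t) * (- lam) by rewrite ler_wpM2l ?subr_ge0// ltW.
  by rewrite lE; lra.
have [eta [nu [eta0 nu0 nu1 nuS nuE]]] := tilted_tree_measure l0 fl.
pose E u := insert vins after_square 0 u.
have lnr0 w : wsum lnr w <= 0 by apply: wsum_le0 => j; exact: ltW (lnr_lt0 j).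
(* The price of one insertion in the exponent. The total A [isqrt] |v| is absorbed by l/2 |v|, up to
   the constant [K] from short words. *)
pose A := t * - wsum lnr vins.
have A0 : 0 <= A by rewrite mulr_ge0 ?oppr_ge0// ltW.
have l20 : 0 < l / 2 by rewrite divr_gt0.
have [m0 m0H] := linear_le_sqr A l20.
pose K := A * m0%:R.
have nuK v : nu v <= expR K * expR (t * wsum lnr (E v)).
  apply: le_trans (nuE v) _; rewrite -expRD ler_expR wsumZ wsum_insert.
  have e1 : 0 <= eta * wsum x v ^+ 2 by rewrite mulr_ge0 ?sqr_ge0// ltW.
  suff : A * (isqrt (size v))%:R <= K + l / 2 * (size v)%:R by rewrite /A; lra.
  have K0 : 0 <= K by rewrite mulr_ge0.
  have [mm|mm] := leqP m0 (isqrt (size v)); last first.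
    rewrite -[leLHS]addr0; apply: lerD; last by apply: mulr_ge0 => //; exact: ltW.
    by rewrite ler_wpM2l// ler_nat ltnW.
  apply: (@le_trans _ _ (l / 2 * (isqrt (size v))%:R ^+ 2)).
    by apply: le_trans (m0H _ mm); rewrite ler_wpM2l// lerDl.
  apply: (@le_trans _ _ (l / 2 * (size v)%:R)); last by rewrite lerDr.
  rewrite ler_pM2l// -natrX ler_nat.
  by case/andP: (isqrtP (size v)).
have kR : 1 <= k%:R :> R by rewrite ler1n.
have k0R : 0 < k%:R :> R by rewrite ltr0n.
have [N0 N0H] : exists N0, forall N, (N0 <= N)%N ->
    k%:R * expR (- (eta * N%:R)) <= 4^-1.
  by apply: expR_decay; rewrite ?invr_gt0.
pose N := maxn 1 N0; pose L : R := N%:R.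
have L1 : 1 <= L by rewrite ler1n leq_maxl.
have kL : k%:R * expR (- (eta * L)) <= 4^-1 by apply: N0H; exact: leq_maxr.
(* The Gaussian factor leaves each pruned word of length n at most exp(- eta L (n + 1)). There are
   at most k^n of them, so by the choice of L they weigh at most 4^-(n + 1); n + 1 rather than n
   gives a gain already at the empty word. *)
pose P n := [seq w <- words k n | L * n.+1%:R < wsum x w ^+ 2].
have sumP n : \sum_(w <- P n) nu w <= 2^-1 / (2 ^ n.+1)%:R.
  apply: (@le_trans _ _ ((k%:R * expR (- (eta * L))) ^+ n.+1)); last first.
    apply: (@le_trans _ _ (4^-1 ^+ n.+1)).
      by rewrite lerXn2r// nnegrE ?mulr_ge0 ?expR_ge0 ?invr_ge0.
    have -> : 4^-1 = 2^-1 * 2^-1 :> R by rewrite -invfM; congr (_^-1); lra.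
    rewrite exprMn natrX -exprVn ler_wpM2r ?exprn_ge0 ?invr_ge0//.
    by rewrite exprS ler_piMr ?invr_ge0// exprn_ile1 ?invr_ge0//; lra.
  rewrite big_filter big_mkcond/=.
  apply: (@le_trans _ _ (\sum_(w <- words k n) expR (- (eta * L)) ^+ n.+1)).
    apply: ler_sum => w _; case: ifPn => [Lw|_]; last by rewrite exprn_ge0 ?expR_ge0.
    apply: le_trans (nuE w) _; rewrite -expRM_natr ler_expR wsumZ.
    have : t * wsum lnr w <= 0 by rewrite pmulr_rle0.
    have : 0 <= l / 2 * (size w)%:R by rewrite mulr_ge0// ltW.
    have := ltW Lw; rewrite -(ler_pM2l eta0) => ? ? ?; lra.
  rewrite big_const_seq count_predT iter_addr_0 size_words -[leLHS]mulr_natl natrX.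
  rewrite exprMn ler_wpM2r ?exprn_ge0 ?expR_ge0//.
  by rewrite exprS ler_peMl ?exprn_ge0// ltW.
have HB0 : 0 < hit_bound vins by rewrite mulr_gt0 ?expR_gt0.
pose C1 := hit_bound vins * expR K; have C10 : 0 < C1 by rewrite mulr_gt0 ?expR_gt0.
(* The budget: 1/8 for the sum of the cover, 1/8 for the errors of the scales, 1/2 for the pruned
   words. *)
pose e1 := (8 * C1)^-1; have e10 : 0 < e1 by rewrite invr_gt0 mulr_gt0.
have CE : C1 * e1 = 8^-1 by rewrite /e1 invfM mulrCA divff ?mulr1// gt_eqF.
move=> HE0.
have : (hausdorff_premeasure s 1 (lower_level_set mu alpha) < e1%:E)%E.
  apply: (@le_lt_trans _ _ 0%E); last by rewrite lte_fin.
  by rewrite -HE0; apply: ereal_sup_ubound; exists 1 => //=; exact: ltr01.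
move=> /ereal_inf_lt[_ [U [EU Ud] <-] sumU].
have hit i : exists H : seq (seq 'I_k),
    ((\sum_(v <- H) nu v)%:E <= C1%:E * gauge s (U i) + (C1 * e1 / (2 ^ i.+1)%:R)%:E)%E /\
    (forall om pt, U i pt -> (forall n, exists2 y, 0 <= y <= 1 &
       pt = psiw (E (mkseq om n)) y) -> exists m, mkseq om m \in H).
  have ei : 0 < e1 / (2 ^ i.+1)%:R by rewrite divr_gt0// ltr0n expn_gt0.
  have [U0|/set0P Un] := eqVneq (U i) set0.
    exists [::]; split; last by move=> om pt; rewrite U0.
    rewrite big_nil adde_ge0// ?mule_ge0 ?gauge_ge0// lee_fin ?(ltW C10)//.
    by rewrite -mulrA mulr_ge0// ltW.
  have [d [d0 d1 Udd dg]] := gauge_scale s0 st ei Un (Ud i).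
  have [n nd] : exists n, - (lam * n%:R) <= ln d.
    have [n /(_ n (leqnn _))] := expR_decay ltr01 lam0 d0.
    by rewrite mul1r -[X in _ <= X]lnK ?posrE// ler_expR => nd; exists n.
  exists (hits vins after_square n d (U i)); split; last first.
    by move=> om pt Upt code; exact: hits_path Upt code.
  apply: (@le_trans _ _ (C1 * d `^ t)%:E); last first.
    rewrite -mulrA EFinM [X in (_ + X)%E]EFinM.
    rewrite -ge0_muleDr ?gauge_ge0 ?lee_fin ?(ltW ei)//.
    by apply: lee_wpmul2l => //; rewrite lee_fin ltW.
  rewrite lee_fin.
  apply: (@le_trans _ _ (\sum_(v <- hits vins after_square n d (U i)) expR K * d `^ t)).
    rewrite big_seq [leRHS]big_seq; apply: ler_sum => v vh.
    apply: le_trans (nuK v) _; rewrite ler_pM2l ?expR_gt0// /powR gt_eqF// ler_expR.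
    rewrite ler_pM2l//.
    by have /andP[] := hits_scale lamH d1 nd vh.
  rewrite big_const_seq count_predT iter_addr_0 -[leLHS]mulr_natl /C1 -mulrA.
  rewrite ler_wpM2r ?mulr_ge0 ?expR_ge0 ?powR_ge0//.
  by apply: size_hits lamH _ nd Udd; rewrite d0.
have [H HH] := choice hit.
have [|om omV] := @infinite_path_avoiding R k nu (fun i => H i ++ P i) nu0 nu1 nuS.
  apply: (@le_lt_trans _ _ (\sum_(0 <= i <oo) (C1%:E * gauge s (U i) +
     ((C1 * e1 + 2^-1) / (2 ^ i.+1)%:R)%:E))%E).
    apply: lee_nneseries => i _; first by rewrite lee_fin sumr_ge0.
    rewrite big_cat/= EFinD mulrDl EFinD addeA; apply: leeD; first exact: (HH i).1.
    by rewrite lee_fin.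
  apply: (le_lt_trans (epsilon_trick _ _ _)).
  - by move=> i; rewrite mule_ge0 ?gauge_ge0// lee_fin ltW.
  - by rewrite CE; lra.
  rewrite nneseriesZl; last by move=> i _; exact: gauge_ge0.
  apply: (@le_lt_trans _ _ ((C1 * e1)%:E + (C1 * e1 + 2^-1)%:E)%E).
    apply: leeD; last by [].
    by rewrite [leRHS]EFinM; apply: lee_wpmul2l; [rewrite lee_fin ltW|exact: ltW].
  by rewrite -EFinD lte_fin CE; lra.
have omL n : wsum x (mkseq om n) ^+ 2 <= L * n.+1%:R.
  rewrite leNgt; apply/negP => Ln; have := omV n n.
  by rewrite mem_cat negb_or => /andP[_]; rewrite mem_filter Ln mem_words size_mkseq eqxx.
have [pt ptE] := path_point vins om.
have /EU[i _ Upt] := level_point c00 core L1 omL ptE.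
have [m mH] := (HH i).2 om pt Upt ptE.
by have := omV m i; rewrite mem_cat mH.
Qed.

End self_similar_mass.
End iterated_function_system.

(** * The spectrum *)

(** A second nondegenerate interval leaves room beside each J_j, so the ratios are below 1. It also
    makes a word available whose cylinder stays away from 0 and 1. *)
Lemma interval_system_slopes (R : realType) (k : nat) (a b : 'I_k -> R)
    (psi : 'I_k -> R -> R) : (2 <= k)%N -> interval_system a b psi ->
  exists c : 'I_k -> R,
    [/\ [/\ forall j x y, psi j x - psi j y = c j * (x - y),
            forall j, 0 < `|c j| < 1 & forall j, Lip (psi j) = `|c j|],
        forall j x, 0 <= x <= 1 -> 0 <= psi j x <= 1,
        forall i j x y, i != j -> 0 <= x <= 1 -> 0 < y < 1 ->
          psi i x != psi j y &
        exists v c0, 0 < c0 /\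
          forall x, 0 <= x <= 1 -> c0 <= psiw psi v x <= 1 - c0].
Proof.
move=> k2 [ab ord aff img].
have /choice[c cP] : forall j, exists cj, forall x y, psi j x - psi j y = cj * (x - y).
  by move=> j; have [cj [d H]] := aff j; exists cj => x y; rewrite !H; ring.
have psiI j x : 0 <= x <= 1 -> a j <= psi j x <= b j.
  move=> x01; have : (psi j @` `[0, 1]%classic) (psi j x) by exists x; rewrite //= in_itv.
  by rewrite img /= in_itv.
have in0 : 0 <= (0 : R) <= 1 by rewrite lexx ler01.
have in1 : 0 <= (1 : R) <= 1 by rewrite lexx ler01.
have cE j : `|c j| = b j - a j.
  have [_ abj _] := ab j.
  have pre z : a j <= z <= b j -> exists2 x, 0 <= x <= 1 & psi j x = z.
    move=> zab; have : `[a j, b j]%classic z by rewrite /= in_itv.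
    by rewrite -img => -[x]; rewrite /= in_itv/= => x01 xz; exists x.
  apply/eqP; rewrite eq_le; apply/andP; split.
    have := cP j 1 0; rewrite subr0 mulr1 => <-.
    have /andP[? ?] := psiI j _ in0; have /andP[? ?] := psiI j _ in1.
    by rewrite ler_norml; apply/andP; split; lra.
  have [x x01 xa] := pre (a j) ltac:(by rewrite lexx ltW).
  have [y y01 yb] := pre (b j) ltac:(by rewrite lexx ltW).
  rewrite -xa -yb cP; apply: le_trans (ler_norm _) _; rewrite normrM ler_piMr//.
  by rewrite ler_norml; move: x01 y01 => /andP[? ?] /andP[? ?]; apply/andP; split; lra.
have c0 j : 0 < `|c j| by have [_ ? _] := ab j; rewrite cE subr_gt0.
have psi_oo' j y : 0 < y < 1 -> a j < psi j y < b j.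
  move=> /andP[y0 y1]; have E0 := cP j y 0; have E1 := cP j 1 y.
  have /andP[? ?] := psiI j _ in0; have /andP[? ?] := psiI j _ in1.
  have := c0 j; rewrite normr_gt0 neq_lt subr0 in E0 * => /orP[cl|cg].
  - have ? : c j * y < 0 by rewrite nmulr_rlt0.
    have ? : c j * (1 - y) < 0 by rewrite nmulr_rlt0// subr_gt0.
    by apply/andP; split; lra.
  - have ? : 0 < c j * y by rewrite mulr_gt0.
    have ? : 0 < c j * (1 - y) by rewrite mulr_gt0// subr_gt0.
    by apply/andP; split; lra.
pose i0 : 'I_k := Ordinal (ltnW k2); pose i1 : 'I_k := Ordinal k2.
have b01 : b i0 <= a i1 by exact: ord.
exists c; split.
- split=> // j.
    rewrite c0 cE /=; have [aj0 abj bj1] := ab j.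
    have [/ord|/ord|/val_inj ji0] := ltngtP i0 j; first by have [? ? ?] := ab i0; lra.
      by have [? ? ?] := ab i0; lra.
    by rewrite -ji0 in aj0 abj bj1 *; have [? ? ?] := ab i1; lra.
  apply/eqP; rewrite eq_le; apply/andP; split.
    apply: ge_inf; first by exists 0 => L [].
    split; first exact: normr_ge0.
    by move=> [x y] _ /=; rewrite cP normrM.
  apply: lb_le_inf; first by exists `|c j|; split => // -[x y] _ /=; rewrite cP normrM.
  move=> L [_ LL]; have /= := LL (1, 0); rewrite cP subr0 mulr1 normr1 mulr1; apply.
  by split; rewrite /= in_itv/=.
- move=> j x /(psiI j)/andP[? ?]; have [? ? ?] := ab j; apply/andP; split; lra.
- move=> i j x y ij /(psiI i)/andP[? ?] /(psi_oo' j)/andP[? ?].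
  rewrite neq_lt; have [/ord|/ord|/val_inj ij'] := ltngtP i j.
  + by move=> ?; apply/orP; left; lra.
  + by move=> ?; apply/orP; right; lra.
  + by rewrite ij' eqxx in ij.
- have [a00 ab0 b01'] := ab i0; have [a10 ab1 b11] := ab i1.
  have up x : 0 <= x <= 1 -> psi i0 x <= b i0 by move=> /(psiI i0)/andP[].
  have b1 : b i0 < 1 by lra.
  (* The first interval ends before 1, so only 0 has to be avoided. If its map reverses orientation,
     applying it twice does so; otherwise the second interval, which starts to the right of 0, is
     mapped into the first. *)
  suff [v [e [e0 H]]] : exists v e, 0 < e /\
      forall x, 0 <= x <= 1 -> 0 <= psiw psi v x <= 1 /\ e <= psi i0 (psiw psi v x).
    exists (i0 :: v), (Num.min e (1 - b i0)); split; first by rewrite lt_min e0 subr_gt0.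
    move=> x /H[v01 ev] /=; rewrite ge_min ev/=; have := up _ v01.
    have : Num.min e (1 - b i0) <= 1 - b i0 by rewrite ge_min lexx orbT.
    lra.
  have /andP[p00 _] := psiI i0 _ in0; have /andP[p10 _] := psiI i0 _ in1.
  have := c0 i0; rewrite normr_gt0 neq_lt => /orP[cl|cg].
  + exists [:: i0], (- c i0 * (1 - b i0)); split.
      by rewrite mulr_gt0 ?oppr_gt0 ?subr_gt0.
    move=> x x01 /=; have /andP[l1 l2] := psiI i0 _ x01.
    split; first by apply/andP; split; lra.
    have := cP i0 (psi i0 x) 1.
    have : c i0 * (b i0 - 1) <= c i0 * (psi i0 x - 1) by rewrite ler_nM2l// lerD2r.
    lra.
  + exists [:: i1], (c i0 * a i1); split; first by rewrite mulr_gt0//; lra.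
    move=> x x01 /=; have /andP[l1 l2] := psiI i1 _ x01.
    split; first by apply/andP; split; lra.
    have := cP i0 (psi i1 x) 0.
    have : c i0 * a i1 <= c i0 * psi i1 x by rewrite ler_pM2l.
    lra.
Qed.

Theorem corollary8p1 (R : realType) (k : nat) (hk : (2 <= k)%N)
    (a b : 'I_k -> R) (psi : 'I_k -> R -> R)
    (hpsi : interval_system a b psi)
    (p : 'I_k -> R) (p_gt0 : forall j, 0 < p j) (p_sum : \sum_(j < k) p j = 1)
    (F : set R) (hF : self_similar_set psi F)
    (mu : probability (measurableTypeR R) R)
    (hmu : self_similar_measure psi p F mu)
    (nondeg : ~ (`[0 : R, 1 : R]%classic `<=` \bigcup_j `[a j, b j]%classic /\
                 forall j, p j = Lip (psi j)))
    (beta : R -> R)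
    (hbeta : forall q, \sum_(j < k) p j `^ q * Lip (psi j) `^ beta q = 1)
    (alpha : R) :
  let r := fun j => Lip (psi j) in
  ((alpha_min p r <= alpha%:E)%E /\ (alpha%:E <= alpha_max p r)%E ->
     hausdorff_dim (lower_level_set mu alpha) = beta_star beta alpha) /\
  (~ ((alpha_min p r <= alpha%:E)%E /\ (alpha%:E <= alpha_max p r)%E) ->
     lower_level_set mu alpha = set0).
Proof.
move=> r; have [c [[psiB c01 LipE] psi01 psi_sep [v [c0 [c00 core]]]]] :=
  interval_system_slopes hk hpsi.
have [_ Fc F01 FS] := hF; have [muF muS] := hmu.
have mF : measurable (F : set (measurableTypeR R)).
  apply: measurable_realfun.closed_measurable.
  by apply: compact_closed => //; exact: Rhausdorff.
have mu01 : mu `[0 : R, 1 : R]%classic = 1%E.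
  apply/eqP; rewrite eq_le probability_le1//= -muF.
  by apply: le_measure; rewrite ?inE.
have hb q : \sum_j expR (q * lnp p j + beta q * lnr c j) = 1.
  rewrite -(hbeta q); apply: eq_bigr => j _; rewrite LipE expRD /powR.
  by rewrite gt_eqF// gt_eqF//; case/andP: (c01 j).
have lnrE j : ln (p j) / ln (r j) = lnp p j / lnr c j by rewrite /r LipE.
have rangeE : (alpha_min p r <= alpha%:E)%E /\ (alpha%:E <= alpha_max p r)%E <->
    (exists j, alpha * lnr c j <= lnp p j) /\ (exists j, lnp p j <= alpha * lnr c j).
  have minE : (alpha_min p r <= alpha%:E)%E <-> exists j, alpha * lnr c j <= lnp p j.
    split=> [/bigmin_leP[//|[j _]]|[j jH]].
      by rewrite lee_fin lnrE ler_ndivrMr ?lnr_lt0// => jH; exists j.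
    by apply/bigmin_leP; right; exists j => //; rewrite lee_fin lnrE ler_ndivrMr ?lnr_lt0.
  have maxE : (alpha%:E <= alpha_max p r)%E <-> exists j, lnp p j <= alpha * lnr c j.
    split=> [/bigmax_geP[//|[j _]]|[j jH]].
      by rewrite lee_fin lnrE ler_ndivlMr ?lnr_lt0// => jH; exists j.
    by apply/bigmax_geP; right; exists j => //; rewrite lee_fin lnrE ler_ndivlMr ?lnr_lt0.
  by rewrite minE maxE.
split; last first.
  move=> nrange; apply/seteqP; split=> // t [_ ta]; apply: nrange; apply/rangeE.
  exact (lower_local_dim_range psiB c01 psi01 psi_sep p_gt0 muS mu01 F01 Fc FS
    muF ta).
move=> /rangeE[[j1 j1H] [j2 j2H]]; apply/eqP; rewrite eq_le; apply/andP; split.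
  apply: le_ereal_inf_tmp => _ [q _ <-].
  apply: (hausdorff_dim_level_le psiB c01 psi01 psi_sep p_gt0 muS mu01 F01 Fc FS muF);
    rewrite ?hb//.
  (* This gives alpha q + beta(q) >= 0: the j-th term of the sum defining beta(q) is at most 1, so
     (alpha q + beta(q)) log r_j <= q log p_j + beta(q) log r_j <= 0, with log r_j < 0. *)
  have [j jH] : exists j, q * (lnp p j - alpha * lnr c j) >= 0.
    have [q0|/ltW q0] := leP 0 q.
      by exists j1; rewrite mulr_ge0// subr_ge0.
    by exists j2; rewrite mulr_le0// subr_le0.
  have : expR (q * lnp p j + beta q * lnr c j) <= 1.
    by rewrite -(hb q) (bigD1 j)//= lerDl sumr_ge0// => i _; exact: expR_ge0.
  rewrite expR_le1 => H; have jr := lnr_lt0 c01 j.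
  rewrite -(nmulr_lle0 _ jr); lra.
apply: le_ereal_inf_tmp => _ [s [s0 sH] <-]; rewrite leNgt; apply/negP => sb.
have bq q : (beta_star beta alpha <= (alpha * q + beta q)%:E)%E.
  by apply: ereal_inf_lbound; exists q.
case bE : (beta_star beta alpha) sb bq => [s1| |] // ss1 bq.
  move: sH; apply: (hausdorff_measure_level_neq0 psiB c01 psi01 psi_sep p_gt0 muS mu01
    _ c00 core s0 ss1); first exact: ltnW.
  (* As s1 - alpha q <= beta(q) and log r_j < 0, each term is at least the corresponding term of the
     sum that defines beta(q). *)
  move=> q; rewrite -(hb q); apply: ler_sum => j _; rewrite ler_expR.
  have := bq q; rewrite lee_fin => sq.
  have : beta q * lnr c j <= (s1 - alpha * q) * lnr c j.
    by rewrite ler_wnM2r ?(ltW (lnr_lt0 c01 j))//; lra.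
  lra.
by have := bq 0; rewrite leye_eq.
Qed.
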